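(* Fix reals $\alpha,\beta,\gamma,\delta\ge0$ with $\alpha+\beta+\gamma+\delta=1$ satisfying $\alpha+\gamma>0$, $\beta>0$, $\delta>0$. Put $D:=1-4(\alpha\gamma+\alpha\delta+\beta\gamma)$, $\mu:=(1-\sqrt D)/2$, $\sigma^2:=(\alpha+\gamma)\beta\delta/D$. Consider $n\to\infty$ along integers $n$ for which $l:=\alpha n$, $m:=(\alpha+\beta)n$, $k:=(\alpha+\gamma)n$ are integers, and let $X$ be distributed according to $p(\cdot\mid n,m,k,l)$. Then \[ \lim_{n\to\infty}\mathbb V\Bigl[\frac{X}{\sqrt n}\Bigr]=\lim_{n\to\infty}\mathbb E\Bigl[\Bigl(\frac{X-n\mu}{\sqrt n}\Bigr)^2\Bigr]=\sigma^2, \] and \[ \mathbb E[X]=n\mu+\phi+o(1),\qquad \phi:=\frac{\sigma^2-\mu}{1-2\mu}. \]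
   Context: For non-negative integers $n,m,k,l$ with $m,k\le n$ and $m+k-n\le l\le\min(m,k)$, let $M:=m-l$, $N:=n-m-k+l$. Let $\mathbb{C}^2$ have orthonormal basis $|0\rangle,|1\rangle$ and give $(\mathbb{C}^2)^{\otimes n}$ the induced Hermitian inner product. Define $|\Xi_{n,m|k,l}\rangle:=|1\rangle^{\otimes l}\otimes|0\rangle^{\otimes(k-l)}\otimes\binom{M+N}{M}^{-1/2}\sum_{I}|I\rangle$, the sum over all $I\in\{0,1\}^{n-k}$ with exactly $M$ ones (where $|i_1\cdots i_r\rangle=|i_1\rangle\otimes\cdots\otimes|i_r\rangle$). $\mathfrak S_n$ acts on $(\mathbb{C}^2)^{\otimes n}$ by permuting tensor factors. For $0\le x\le\lfloor n/2\rfloor$, $\mathsf P_{(n-x,x)}$ is the orthogonal projection onto the isotypic component of the irreducible $\mathfrak S_n$-representation labelled by the partition $(n-x,x)$, and $p(x\mid n,m,k,l):=\langle\Xi_{n,m|k,l}|\mathsf P_{(n-x,x)}|\Xi_{n,m|k,l}\rangle$, a probability mass function on $\{0,\dots,\lfloor n/2\rfloor\}$. *)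

(* Defs.v *)
From HB Require Import structures.
From Stdlib Require Import ClassicalEpsilon.
From mathcomp Require Import all_boot all_order all_algebra all_fingroup.
From mathcomp Require Import reals complex.
Set Implicit Arguments.
Unset Strict Implicit.
Unset Printing Implicit Defensive.
Import Order.TTheory GRing.Theory Num.Theory.
Local Open Scope ring_scope.

Section QubitDefs.
Variable R : realType.
Local Notation C := (R[i]).

(* computational basis labels |i_1 ... i_n> of (C^2)^{⊗n}; false = |0>, true = |1> *)
Definition bits (n : nat) := {ffun 'I_n -> bool}.

(* vectors of (C^2)^{⊗n}, written in the computational basis *)
Definition qstate (n : nat) := {ffun bits n -> C}.

Definition cscale n (a : C) (v : qstate n) : qstate n := [ffun I => a * v I].
Definition hdot n (u v : qstate n) : C := \sum_(I : bits n) conjc (u I) * v I.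

Definition permact n (s : 'S_n) (v : qstate n) : qstate n :=
  [ffun I : bits n => v [ffun i => I (s i)]].

(* Polytabloid of a Young tableau of shape (n-x,x): column c has top entry a c
   and bottom entry b c; the remaining n-2x entries lie in the first row.
   Under the identification of tabloids of shape (n-x,x) with basis vectors
   having ones exactly at the second-row entries, the polytabloid
   e_t = sum_{s in column group} sgn(s) s{t} is
   prod_c (|0>_{a c}|1>_{b c} - |1>_{a c}|0>_{b c}) (x) |0...0>_rest. *)
Definition tableau_ok n x (a b : {ffun 'I_x -> 'I_n}) : bool :=
  uniq (codom a ++ codom b).

Definition polytab n x (a b : {ffun 'I_x -> 'I_n}) : qstate n :=
  [ffun I : bits n =>
     (\prod_(c < x) ((~~ I (a c) && I (b c))%:R - (I (a c) && ~~ I (b c))%:R)) *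
     (\prod_(i < n | (i \notin codom a) && (i \notin codom b)) (~~ I i)%:R)].

Definition in_specht n x (v : qstate n) : Prop :=
  exists coef : {ffun {ffun 'I_x -> 'I_n} * {ffun 'I_x -> 'I_n} -> C},
    v = \sum_(t | tableau_ok t.1 t.2) cscale (coef t) (polytab t.1 t.2).

Definition equivariant_lin n (f : qstate n -> qstate n) : Prop :=
  (forall (a : C) (u v : qstate n), f (cscale a u + v) = cscale a (f u) + f v) /\
  (forall (s : 'S_n) (v : qstate n), f (permact s v) = permact s (f v)).

(* isotypic component of the irreducible S_n-representation labelled by (n-x,x):
   the sum of the images of the Specht module S^{(n-x,x)} under all
   S_n-equivariant linear maps into (C^2)^{⊗n}
   (= the sum of all subrepresentations isomorphic to S^{(n-x,x)}) *)
Definition in_isotypic n x (v : qstate n) : Prop :=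
  exists fs : seq ((qstate n -> qstate n) * qstate n),
    (forall p, List.In p fs -> equivariant_lin p.1 /\ in_specht x p.2) /\
    v = \sum_(p <- fs) p.1 p.2.

Definition orth_proj n (P : qstate n -> Prop) (v : qstate n) : qstate n :=
  epsilon (inhabits 0) (fun w => P w /\ forall u, P u -> hdot u (v - w) = 0).

Definition Xi (n m k l : nat) : qstate n :=
  let M := (m - l)%N in let N := (n + l - m - k)%N in
  [ffun I : bits n =>
     if [forall i : 'I_n, (i < l)%N ==> I i]
        && [forall i : 'I_n, ((l <= i) && (i < k))%N ==> ~~ I i]
        && (#|[set i : 'I_n | (k <= i)%N && I i]| == M)
     then (((Num.sqrt (('C(M + N, M))%:R))^-1)%:C)%C
     else 0].

(* p(x | n,m,k,l) = <Xi| P_{(n-x,x)} |Xi>  (a real number; we take its real part) *)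
Definition pmf (n m k l x : nat) : R :=
  complex.Re (hdot (Xi n m k l) (orth_proj (@in_isotypic n x) (Xi n m k l))).

Definition expect (n m k l : nat) (g : R -> R) : R :=
  \sum_(x < (n./2).+1) g x%:R * pmf n m k l x.

Definition adm_lim (al be ga : R) (f : nat -> nat -> nat -> nat -> R) (L : R) : Prop :=
  forall eps : R, 0 < eps -> exists n0 : nat, forall n m k l : nat,
    (n0 <= n)%N -> l%:R = al * n%:R -> m%:R = (al + be) * n%:R ->
    k%:R = (al + ga) * n%:R -> `|f n m k l - L| < eps.

End QubitDefs.

(* Main.v *)
Require Import Defs.
From HB Require Import structures.
From Stdlib Require Import ClassicalEpsilon.
From mathcomp Require Import all_boot all_order all_algebra all_fingroup.
From mathcomp Require Import reals complex.
From mathcomp Require Import ring lra zify.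
Set Implicit Arguments.
Unset Strict Implicit.
Unset Printing Implicit Defensive.
Import Order.TTheory GRing.Theory Num.Theory.
Local Open Scope ring_scope.

(* The Casimir element [sum_{i<j} (1 - (i j))] acts by [x (n + 1 - x)] on the
   isotypic component of [(n - x, x)], so the moments of [Y = X (n + 1 - X)] are
   the matrix elements [<Xi| casimir^p |Xi>].  The Casimir element moves the state
   [Xi] only inside the span of the vectors invariant under permutations of the
   three blocks of sites, where it is the generator of a random walk in two
   variables [(d, e)] started at the origin; this gives the first two moments of
   [Y] exactly and the bound [O(n^6)] on the centred fourth moment.  The map from
   [X] to [Y] is quadratic with slope of order [n] at [n mu], because [mu < 1/2],
   so these moments determine the mean and the variance of [X] up to errors of
   relative order [n^(-1/2)]. *)

(** * The Casimir element *)

(** The projection is known only through its characterisation under [epsilon], and the isotypic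
    component only as a sum of equivariant images. Nothing can be computed before the components
    with [x <= n/2] are shown to span the whole space and to be mutually orthogonal. Spanning is
    obtained by creating singlets; orthogonality comes from the distinct eigenvalues of the
    self-adjoint Casimir element. No formula for the mass function is needed after that.

    [Y] is centred at [y = n mu (n + 1 - n mu)]. Since [mu] is the smaller root of
    [t (1 - t) = al ga + al de + be ga], and the right side is [E[Y] / n^2], the order [n^2] cancels
    and [E[Y] - y = - n mu] exactly. With [Z = X - n mu] and [q = sqrt D = 1 - 2 mu] one has
    [Y - y = Z (q n + 1 - Z)]. Its square contains [Z^3] and [Z^4], for which the trivial bound
    [|Z| <= n] is too weak; the fourth moment of [Y] serves to control them. *)

Section Vectors.
Variables (R : realType) (n : nat).
Local Notation C := (R[i]).
Implicit Types (u v w : qstate R n) (I J : bits n) (f : qstate R n -> qstate R n).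

Lemma cscaleE (a : C) v I : cscale a v I = a * v I.
Proof. by rewrite ffunE. Qed.

Lemma cscaleDr (a : C) u v : cscale a (u + v) = cscale a u + cscale a v.
Proof. by apply/ffunP => I; rewrite !ffunE mulrDr. Qed.

Lemma cscale_sumr (a : C) (T : Type) (r : seq T) (P : pred T) F :
  cscale a (\sum_(i <- r | P i) F i) = \sum_(i <- r | P i) cscale a (F i) :> qstate R n.
Proof.
apply/ffunP => I; rewrite cscaleE !sum_ffunE mulr_sumr.
by apply: eq_bigr => i _; rewrite cscaleE.
Qed.

Lemma cscaleA (a b : C) v : cscale a (cscale b v) = cscale (a * b) v.
Proof. by apply/ffunP => I; rewrite !ffunE mulrA. Qed.

Lemma cscale1 v : cscale 1 v = v.
Proof. by apply/ffunP => I; rewrite !ffunE mul1r. Qed.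

Lemma cscaleN1 v : cscale (-1) v = - v.
Proof. by apply/ffunP => I; rewrite !ffunE mulN1r. Qed.

Lemma cscaler0 (a : C) : cscale a 0 = 0 :> qstate R n.
Proof. by apply/ffunP => I; rewrite !ffunE mulr0. Qed.

Lemma hdotDr u v w : hdot u (v + w) = hdot u v + hdot u w.
Proof.
by rewrite /hdot -big_split; apply: eq_bigr => I _; rewrite !ffunE mulrDr.
Qed.

Lemma hdotZr (a : C) u v : hdot u (cscale a v) = a * hdot u v.
Proof.
by rewrite /hdot mulr_sumr; apply: eq_bigr => I _; rewrite cscaleE mulrCA.
Qed.

Lemma hdotBr u v w : hdot u (v - w) = hdot u v - hdot u w.
Proof. by rewrite hdotDr -cscaleN1 hdotZr mulN1r. Qed.

Lemma hdot_sumr (T : Type) (r : seq T) (P : pred T) u F :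
  hdot u (\sum_(i <- r | P i) F i) = \sum_(i <- r | P i) hdot u (F i).
Proof.
elim/big_rec2: _ => [|i y v _ <-]; last by rewrite hdotDr.
by rewrite /hdot big1 // => I _; rewrite ffunE mulr0.
Qed.

Lemma conjcM (a b : C) : conjc (a * b) = conjc a * conjc b.
Proof. exact: rmorphM. Qed.

Lemma conjcB (a b : C) : conjc (a - b) = conjc a - conjc b.
Proof. exact: rmorphB. Qed.

Lemma conjc_sum (T : Type) (r : seq T) (P : pred T) (F : T -> C) :
  conjc (\sum_(i <- r | P i) F i) = \sum_(i <- r | P i) conjc (F i).
Proof. exact: (rmorph_sum (@conjc R)). Qed.

Lemma hdotC u v : hdot v u = conjc (hdot u v).
Proof.
rewrite /hdot conjc_sum; apply: eq_bigr => I _.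
by rewrite conjcM conjcK mulrC.
Qed.

Lemma hdot_eq0 v : hdot v v = 0 -> v = 0.
Proof.
move=> h; apply/ffunP => I; rewrite ffunE; apply/eqP.
have h0 J : true -> 0 <= conjc (v J) * v J.
  by move=> _; rewrite mulrC -sqr_normc exprn_ge0.
move/eqP: h; rewrite psumr_eq0 // => /allP /(_ I); rewrite mem_index_enum.
move=> /(_ isT) /=; rewrite mulf_eq0 conjc_eq0.
by case/orP.
Qed.

Lemma hdot_ge0 v : 0 <= complex.Re (hdot v v).
Proof.
have : 0 <= hdot v v.
  by apply: sumr_ge0 => J _; rewrite mulrC -sqr_normc exprn_ge0.
by rewrite lecE => /andP[].
Qed.

Lemma equivariant_lin0 f : equivariant_lin f -> f 0 = 0.
Proof.
case=> lin _; have := lin 1 0 0; rewrite !cscale1 addr0 => /eqP.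
by rewrite -subr_eq0 opprD addrA subrr sub0r oppr_eq0 => /eqP.
Qed.

Lemma equivariant_linZ f (a : C) v : equivariant_lin f -> f (cscale a v) = cscale a (f v).
Proof.
by move=> ef; have := ef.1 a v 0; rewrite !addr0 (equivariant_lin0 ef) addr0.
Qed.

Lemma equivariant_linD f u v : equivariant_lin f -> f (u + v) = f u + f v.
Proof. by move=> ef; have := ef.1 1 u v; rewrite !cscale1. Qed.

Lemma equivariant_linB f u v : equivariant_lin f -> f (u - v) = f u - f v.
Proof.
by move=> ef; rewrite equivariant_linD // -cscaleN1 equivariant_linZ // cscaleN1.
Qed.

Lemma equivariant_lin_sum f (T : Type) (r : seq T) (P : pred T) F :
  equivariant_lin f -> f (\sum_(i <- r | P i) F i) = \sum_(i <- r | P i) f (F i).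
Proof.
move=> ef; elim/big_rec2: _ => [|i y v _ <-]; first exact: equivariant_lin0.
by rewrite equivariant_linD.
Qed.

Lemma equivariant_lin_id : equivariant_lin (@id (qstate R n)).
Proof. by []. Qed.

Lemma equivariant_lin_cscale (a : C) f :
  equivariant_lin f -> equivariant_lin (fun v => cscale a (f v)).
Proof.
move=> [lf ef]; split=> [b u v|s v]; last first.
  by rewrite ef; apply/ffunP => I; rewrite !ffunE.
by rewrite lf cscaleDr !cscaleA mulrC.
Qed.

Lemma hdot_permact (s : 'S_n) u v :
  hdot u (permact s v) = hdot (permact s^-1%g u) v.
Proof.
pose h (I : bits n) := [ffun i => I (s^-1%g i)] : bits n.
pose h' (I : bits n) := [ffun i => I (s i)] : bits n.
have hK : cancel h h' by move=> I; apply/ffunP => i; rewrite !ffunE permK.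
have h'K : cancel h' h by move=> I; apply/ffunP => i; rewrite !ffunE permKV.
rewrite /hdot [LHS](reindex h) /=; last by exists h' => I _.
apply: eq_bigr => I _; rewrite !ffunE; congr (conjc (u _) * v _).
by apply/ffunP => i; rewrite !ffunE permK.
Qed.

Definition weight I : nat := \sum_i I i.

Definition swap_bits I (i j : 'I_n) : bits n := [ffun q => I (tperm i j q)].

Definition set_bit I (i : 'I_n) (b : bool) : bits n :=
  [ffun q => if q == i then b else I q].

(* [sum_{i<j} (1 - (i j))], written over ordered pairs *)
Definition casimir v : qstate R n :=
  cscale 2^-1 (\sum_i \sum_j (v - permact (tperm i j) v)).

Lemma casimir_equivariant f v : equivariant_lin f -> f (casimir v) = casimir (f v).
Proof.
move=> ef; rewrite /casimir equivariant_linZ // equivariant_lin_sum //.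
congr cscale; apply: eq_bigr => i _; rewrite equivariant_lin_sum //.
by apply: eq_bigr => j _; rewrite equivariant_linB // ef.2.
Qed.

Lemma hdotZl (x : R) u v : hdot (cscale (x%:C)%C u) v = (x%:C)%C * hdot u v.
Proof. by rewrite hdotC hdotZr conjcM -hdotC conjc_real. Qed.

Lemma hdot_casimir u v : hdot u (casimir v) = hdot (casimir u) v.
Proof.
have e2 : 2^-1 = ((2^-1 : R)%:C)%C :> C by rewrite -[RHS]/(real_complex R _) fmorphV rmorph_nat.
rewrite /casimir e2 hdotZr hdotZl; congr (_ * _).
rewrite hdot_sumr [RHS]hdotC hdot_sumr conjc_sum; apply: eq_bigr => i _.
rewrite !hdot_sumr conjc_sum; apply: eq_bigr => j _.
by rewrite !hdotBr hdot_permact tpermV conjcB -!hdotC.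
Qed.

(** A pair of sites with equal bits contributes 0, and a pair with different bits occurs in both
    orders, which absorbs the factor [1/2]. *)
Lemma casimirE v I :
  casimir v I = \sum_(i | I i) \sum_(j | ~~ I j) (v I - v (swap_bits I i j)).
Proof.
pose g i j : C := v I - v (swap_bits I i j).
have gC i j : g i j = g j i by rewrite /g /swap_bits tpermC.
have g0 i j : I i = I j -> g i j = 0.
  move=> e; rewrite /g; suff -> : swap_bits I i j = I by rewrite subrr.
  by apply/ffunP => q; rewrite ffunE; case: tpermP => [->|->|].
rewrite /casimir cscaleE sum_ffunE.
under eq_bigr => i _.
  rewrite sum_ffunE.
  under eq_bigr => j _ do rewrite !ffunE -/(swap_bits I i j) -/(g i j).
  over.
rewrite (bigID (fun i => I i)) /=.
rewrite [X in X + _](eq_bigr (fun i => \sum_(j | ~~ I j) g i j)); last first.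
  move=> i Ii; rewrite (bigID (fun i => I i)) /= big1 ?add0r // => j Ij.
  by rewrite g0 // Ii Ij.
rewrite [X in _ + X](eq_bigr (fun i => \sum_(j | I j) g i j)); last first.
  move=> i Ii; rewrite (bigID (fun i => I i)) /= addrC big1 ?add0r // => j Ij.
  by rewrite g0 // (negPf Ii) (negPf Ij).
rewrite [X in _ + X]exchange_big /=.
rewrite [X in _ + X](eq_bigr (fun i => \sum_(j | ~~ I j) g i j)); last first.
  by move=> i _; apply: eq_bigr.
have half (x : C) : 2^-1 * (x + x) = x by field.
exact: half.
Qed.

(* A vector of weight [x] killed by the raising operator is a highest weight
   vector, on which the Casimir element acts by [x (n + 1 - x)]. *)
Lemma casimir_highest x v :
  (forall I, v I != 0 -> weight I = x) ->
  (forall I, \sum_(i | ~~ I i) v (set_bit I i true) = 0) ->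
  casimir v = cscale (x%:R * (n%:R + 1 - x%:R)) v.
Proof.
move=> wv Ev; apply/ffunP => I; rewrite casimirE cscaleE.
(* Take the hypothesis at [I] with the one at [i] removed: refilling [i] gives [v I], filling a zero
   [j] instead gives the swap of [i] and [j]. *)
have step i : I i -> \sum_(j | ~~ I j) v (swap_bits I i j) = - v I.
  move=> Ii; have := Ev (set_bit I i false).
  rewrite (bigD1 i) /=; last by rewrite ffunE eqxx.
  have -> : set_bit (set_bit I i false) i true = I.
    by apply/ffunP => q; rewrite !ffunE; case: eqP => // ->.
  move/eqP; rewrite addrC addr_eq0 => /eqP <-; apply: eq_big => [j|j Ij].
    by rewrite ffunE; case: (eqVneq j i) => [->|_]; rewrite ?Ii ?andbF ?andbT.
  congr (v _); apply/ffunP => q; rewrite !ffunE.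
  case: tpermP => [->|->|/eqP qi /eqP qj]; rewrite ?eqxx ?(negPf qi) ?(negPf qj) ?Ii //.
  by rewrite (negPf Ij); case: eqP => // ij; rewrite -ij Ii in Ij.
have card1 : \sum_(i < n | I i) (1 : C) = (weight I)%:R.
  rewrite /weight natr_sum big_mkcond /=; apply: eq_bigr => i _; by case: (I i).
have card0 : \sum_(i < n | ~~ I i) (1 : C) = n%:R - (weight I)%:R.
  have e : \sum_(i < n) (1 : C) = n%:R by rewrite sumr_const card_ord.
  by rewrite -e [in RHS](bigID (fun i => I i)) /= card1 addrC addrK.
rewrite (eq_bigr (fun i => 1 * ((n%:R - (weight I)%:R + 1) * v I))); last first.
  move=> i Ii; rewrite sumrB step // opprK.
  rewrite (eq_bigr (fun=> 1 * v I)); last by move=> *; rewrite mul1r.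
  rewrite -mulr_suml card0; ring.
rewrite -mulr_suml card1.
have [->|/wv ->] := eqVneq (v I) 0; ring.
Qed.

End Vectors.

(** * Polytabloids *)

Section Polytabloids.
Variables (R : realType) (n : nat).
Local Notation C := (R[i]).
Implicit Types (u v w : qstate R n) (I J : bits n) (f : qstate R n -> qstate R n).

Definition singlet (p q : bool) : C := (~~ p && q)%:R - (p && ~~ q)%:R.

Lemma singletC p q : singlet q p = - singlet p q.
Proof. by rewrite /singlet opprB andbC [q && _]andbC. Qed.

Section Tableau.
Variables (x : nat) (a b : {ffun 'I_x -> 'I_n}).

Definition off : pred 'I_n := fun i => (i \notin codom a) && (i \notin codom b).

(* Singlets on the columns of the tableau, tensored with the basis vector
   [|J>] on the sites outside it. *)
Definition polygen J : qstate R n :=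
  [ffun I : bits n => \prod_(c < x) singlet (I (a c)) (I (b c)) *
     \prod_(i < n | off i) (I i == J i)%:R].

Hypothesis ok : tableau_ok a b.

Lemma tableau_inj_l : injective a.
Proof. by apply/injectiveP; move: ok; rewrite /tableau_ok cat_uniq => /and3P[]. Qed.

Lemma tableau_inj_r : injective b.
Proof. by apply/injectiveP; move: ok; rewrite /tableau_ok cat_uniq => /and3P[]. Qed.

Lemma tableau_neq c d : (a c == b d) = false.
Proof.
apply/eqP => e; move: ok; rewrite /tableau_ok cat_uniq => /and3P[_ /hasPn h _].
by have := h _ (codom_f b d); rewrite /= -e codom_f.
Qed.

Lemma off_neq i : off i -> forall c, (a c == i) = false /\ (b c == i) = false.
Proof.
case/andP=> ia ib c; split; apply/eqP => e.
  by move: ia; rewrite -e codom_f.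
by move: ib; rewrite -e codom_f.
Qed.

Lemma offPn i : ~~ off i -> (exists c, i = a c) \/ (exists c, i = b c).
Proof.
rewrite negb_and !negbK => /orP[] /codomP[c ->]; [left|right]; by exists c.
Qed.

Lemma tableau_size : (x.*2 <= n)%N.
Proof.
have := card_uniqP ok; rewrite size_cat !size_codom card_ord addnn => <-.
by rewrite -[X in (_ <= X)%N]card_ord max_card.
Qed.

Lemma tableau_big (T : Type) (idx : T) (op : Monoid.com_law idx) (g : 'I_n -> T) :
  \big[op/idx]_i g i =
  op (\big[op/idx]_(c < x) op (g (a c)) (g (b c))) (\big[op/idx]_(i < n | off i) g i).
Proof.
rewrite (bigID (fun i => i \in codom a ++ codom b)) /=; congr (op _ _); last first.
  by apply: eq_bigl => i; rewrite mem_cat negb_or.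
by rewrite -big_uniq // big_cat /= !big_image big_split.
Qed.

Lemma singlet_neq0 p q : singlet p q != 0 -> (p + q = 1)%N.
Proof. by case: p; case: q; rewrite /singlet ?subrr ?eqxx. Qed.

Lemma prod_singlet_weight I :
  \prod_(c < x) singlet (I (a c)) (I (b c)) != 0 ->
  weight I = (x + \sum_(i < n | off i) I i)%N.
Proof.
move=> /prodf_neq0 h; rewrite /weight (tableau_big addn); congr addn.
rewrite (eq_bigr (fun=> 1%N)) ?sum1_card ?card_ord // => c _.
exact/singlet_neq0/h.
Qed.

Lemma polytab_off I i : polytab R a b I != 0 -> off i -> I i = false.
Proof.
rewrite ffunE mulf_eq0 negb_or => /andP[_ /prodf_neq0 h] oi.
by have := h _ oi; rewrite pnatr_eq0 eqb0 negbK => /negPf.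
Qed.

Lemma polytab_weight I : polytab R a b I != 0 -> weight I = x.
Proof.
move=> h; rewrite prod_singlet_weight; last first.
  by move: h; rewrite ffunE mulf_eq0 negb_or => /andP[].
by rewrite big1 ?addn0 // => i oi; rewrite (polytab_off h oi).
Qed.

(** The raising operator annihilates a singlet: raising [a c] and raising [b c] give opposite
    amplitudes with the same cofactor [G]. Raising a site outside the tableau leaves the support of
    the polytabloid. *)
Lemma polytab_raise0 I : \sum_(i | ~~ I i) polytab R a b (set_bit I i true) = 0.
Proof.
rewrite big_mkcond (tableau_big +%R) /= [X in _ + X]big1; last first.
  move=> i oi; case: ifP => // _; apply/eqP; apply: contraTT isT => h.
  by have := polytab_off h oi; rewrite ffunE eqxx.
rewrite addr0 big1 // => c _.
pose G := \prod_(d < x | d != c) singlet (I (a d)) (I (b d)) *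
          \prod_(i < n | off i) (~~ I i)%:R.
have -> : polytab R a b (set_bit I (a c) true) = singlet true (I (b c)) * G.
  rewrite ffunE (bigD1 c) //= -mulrA !ffunE eqxx eq_sym tableau_neq; congr (_ * (_ * _)).
    apply: eq_bigr => d dc; rewrite !ffunE (inj_eq tableau_inj_l) (negPf dc).
    by rewrite eq_sym tableau_neq.
  by apply: eq_bigr => i /off_neq/(_ c)[h _]; rewrite ffunE eq_sym h.
have -> : polytab R a b (set_bit I (b c) true) = singlet (I (a c)) true * G.
  rewrite ffunE (bigD1 c) //= -mulrA !ffunE eqxx tableau_neq; congr (_ * (_ * _)).
    apply: eq_bigr => d dc; rewrite !ffunE (inj_eq tableau_inj_r) (negPf dc).
    by rewrite tableau_neq.
  by apply: eq_bigr => i /off_neq/(_ c)[_ h]; rewrite ffunE eq_sym h.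
by rewrite /singlet; case: (I (a c)); case: (I (b c)) => /=; ring.
Qed.

Lemma casimir_polytab :
  casimir (polytab R a b) = cscale (x%:R * (n%:R + 1 - x%:R)) (polytab R a b).
Proof. exact: casimir_highest polytab_weight polytab_raise0. Qed.

End Tableau.

(* The part of weight [m] of the diagonal action of [[1, 0], [1, 1]]. *)
Definition raise_to (m : nat) v : qstate R n :=
  [ffun I : bits n =>
     if weight I == m then \sum_(J : bits n | [forall i, J i ==> I i]) v J else 0].

Lemma raise_to_equivariant m : equivariant_lin (raise_to m).
Proof.
split=> [z u v|s v]; apply/ffunP => I; rewrite !ffunE.
  case: ifP => _; last by rewrite mulr0 addr0.
  by rewrite mulr_sumr -big_split; apply: eq_bigr => J _; rewrite !ffunE.
have -> : weight [ffun i => I (s i)] = weight I.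
  rewrite /weight [RHS](reindex_inj (@perm_inj _ s)) /=.
  by apply: eq_bigr => i _; rewrite ffunE.
case: ifP => _ //.
pose h J : bits n := [ffun i => J (s^-1%g i)].
pose h' J : bits n := [ffun i => J (s i)].
have hK : cancel h h' by move=> J; apply/ffunP => i; rewrite !ffunE permK.
have h'K : cancel h' h by move=> J; apply/ffunP => i; rewrite !ffunE permKV.
rewrite [LHS](reindex h) /=; last by exists h' => J _.
apply: eq_big => [J|J _]; last first.
  by rewrite ffunE; congr (v _); apply: hK.
apply/forallP/forallP => H i.
  by have := H (s i); rewrite !ffunE permK.
by have := H (s^-1%g i); rewrite !ffunE permKV.
Qed.

(** [[[1, 0], [1, 1]]] has determinant 1 and so fixes every singlet, while each [|0>] outside the
    tableau becomes [|0> + |1>]; the entry at [I] therefore depends only on its weight and on the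
    columns. *)
Lemma raise_to_polytab m x (a b : {ffun 'I_x -> 'I_n}) I : tableau_ok a b ->
  raise_to m (polytab R a b) I =
  (weight I == m)%:R * \prod_(c < x) singlet (I (a c)) (I (b c)).
Proof.
move=> ok; rewrite ffunE; case: eqP => _; last by rewrite mul0r.
rewrite mul1r.
case: (boolP [forall c, I (a c) != I (b c)]) => [/forallP disc|]; last first.
  rewrite negb_forall => /existsP[c]; rewrite negbK => /eqP e.
  rewrite [RHS](bigD1 c) //= e /singlet andbN andNb subrr mul0r.
  set S := \sum_(J | _) _.
  (* Exchanging the two sites of a column on which [I] is constant permutes the [J] below [I] and
     reverses the sign, so the sum vanishes. *)
  pose t := tperm (a c) (b c); pose h J : bits n := [ffun i => J (t i)].
  have hK : cancel h h by move=> J; apply/ffunP => i; rewrite !ffunE tpermK.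
  suff SN : S = - S.
    by have : S *+ 2 == 0 :> C; [rewrite mulr2n {1}SN addNr|rewrite mulrn_eq0 => /eqP].
  rewrite -sumrN /S [LHS](reindex h) /=; last by exists h => J _.
  apply: eq_big => [J|J _].
    have It i : I (t i) = I i by rewrite /t; case: tpermP => // ->.
    apply/forallP/forallP => H i; have := H (t i); rewrite !ffunE ?tpermK It //.
  rewrite !ffunE -mulNr; congr (_ * _).
    rewrite (bigD1 c) //= [in RHS](bigD1 c) //= -mulNr; congr (_ * _).
      by rewrite -!/(singlet _ _) !ffunE tpermL tpermR singletC.
    apply: eq_bigr => d dc; rewrite !ffunE /t !tpermD //.
    - by rewrite tableau_neq.
    - by rewrite (inj_eq (tableau_inj_r ok)) eq_sym.
    - by rewrite (inj_eq (tableau_inj_l ok)) eq_sym.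
    - by rewrite eq_sym tableau_neq.
  apply: eq_bigr => i oi; have [h1 h2] := off_neq oi c.
  by rewrite !ffunE /t tpermD // ?h1 ?h2.
(* The support of the polytabloid has a single one in each column and none outside; when the columns
   of [I] are of this kind, [J0] is its only point below [I]. *)
pose J0 : bits n := [ffun i => I i && ~~ off a b i].
have offa c : off a b (a c) = false by rewrite /off codom_f.
have offb c : off a b (b c) = false by rewrite /off codom_f andbF.
rewrite (bigD1 J0) /=; last by apply/forallP => i; rewrite ffunE; apply/implyP => /andP[].
rewrite [X in _ + X]big1 ?addr0.
  rewrite ffunE [X in _ * X]big1 ?mulr1.
    by apply: eq_bigr => c _; rewrite /singlet !ffunE offa offb !andbT.
  by move=> i oi; rewrite ffunE [off _ _ _]oi andbF.
move=> J /andP[/forallP le /eqP ne]; apply/eqP; apply: contraTT isT => h.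
case: ne; apply/ffunP => i; rewrite ffunE.
case: (boolP (off a b i)) => oi; first by rewrite andbF (polytab_off h oi).
rewrite andbT.
have sg c : (J (a c) + J (b c) = 1)%N.
  move: h; rewrite ffunE mulf_eq0 negb_or => /andP[/prodf_neq0 h _].
  exact/singlet_neq0/h.
case: (offPn oi) => -[c ->]; have := sg c; have := disc c; have := le (a c);
  have := le (b c); by case: (J _); case: (J _); case: (I _); case: (I _).
Qed.

(** [polygen a b J] ignores the bits of [J] on the tableau, and the condition [J i ==> off a b i]
    picks one representative of each pattern outside it. At a given [I] only the pattern of [I]
    itself survives. *)
Lemma sum_polygen x (a b : {ffun 'I_x -> 'I_n}) (w : nat) : tableau_ok a b ->
  \sum_(J : bits n | [forall i, J i ==> off a b i] && (\sum_(i < n | off a b i) J i == w)%N)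
    polygen a b J = raise_to (x + w) (polytab R a b).
Proof.
move=> ok; apply/ffunP => I; rewrite raise_to_polytab // sum_ffunE.
under eq_bigr => J _ do rewrite ffunE.
rewrite -mulr_sumr mulrC.
have [->|/(prod_singlet_weight ok) ->] :=
  eqVneq (\prod_(c < x) singlet (I (a c)) (I (b c))) 0; first by rewrite !mulr0.
congr (_ * _); rewrite eqn_add2l.
pose J0 : bits n := [ffun i => I i && off a b i].
have sJ0 : (\sum_(i < n | off a b i) J0 i = \sum_(i < n | off a b i) I i)%N.
  by apply: eq_bigr => i oi; rewrite ffunE oi andbT.
have z J : [forall i, J i ==> off a b i] -> J != J0 ->
    \prod_(i < n | off a b i) (I i == J i)%:R = 0 :> C.
  move=> /forallP le ne; apply/eqP; apply: contraNT ne => /prodf_neq0 h.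
  apply/eqP/ffunP => i; rewrite ffunE; case: (boolP (off a b i)) => oi.
    by have := h _ oi; rewrite pnatr_eq0 eqb0 negbK andbT => /eqP.
  by have := le i; rewrite (negPf oi) implybF andbF => /negPf.
case: eqP => e.
  rewrite (bigD1 J0) /=; last first.
    rewrite sJ0 e eqxx andbT; apply/forallP => i; rewrite ffunE.
    by apply/implyP => /andP[].
  rewrite [X in _ + X]big1 ?addr0.
    by rewrite big1 // => i oi; rewrite ffunE oi andbT eqxx.
  by move=> J /andP[/andP[le _] ne]; rewrite z.
apply: big1 => J /andP[le /eqP s]; apply: z => //; apply: contra_notN e => /eqP eJ.
by rewrite -s eJ sJ0.
Qed.

Definition extend_tab x (a : {ffun 'I_x -> 'I_n}) (j : 'I_n) : {ffun 'I_x.+1 -> 'I_n} :=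
  [ffun c => if unlift ord0 c is Some c' then a c' else j].

Lemma extend_tab0 x (a : {ffun 'I_x -> 'I_n}) j : extend_tab a j ord0 = j.
Proof. by rewrite ffunE unlift_none. Qed.

Lemma extend_tabS x (a : {ffun 'I_x -> 'I_n}) j c : extend_tab a j (lift ord0 c) = a c.
Proof. by rewrite ffunE liftK. Qed.

Lemma codom_extend_tab x (a : {ffun 'I_x -> 'I_n}) j :
  codom (extend_tab a j) = j :: codom a.
Proof.
rewrite !codomE enum_ordSl /= extend_tab0 -map_comp; congr cons.
by apply: eq_map => c; rewrite /= extend_tabS.
Qed.

Lemma extend_tab_ok x (a b : {ffun 'I_x -> 'I_n}) i j :
  tableau_ok a b -> off a b i -> off a b j -> i != j ->
  tableau_ok (extend_tab a j) (extend_tab b i).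
Proof.
rewrite /tableau_ok => ok /andP[ia ib] /andP[ja jb] ij; rewrite !codom_extend_tab.
have /perm_uniq /= -> : perm_eq ((j :: codom a) ++ [:: i] ++ codom b)
    ([:: i] ++ (j :: codom a) ++ codom b) by rewrite perm_catCA.
by rewrite in_cons !mem_cat !negb_or ij ia ib ja jb ok.
Qed.

(** On the sites [i], [j] the difference is [|10> - |01>], itself a singlet; [j] becomes the top
    entry because a singlet is positive where its bottom bit is 1. *)
Lemma polygen_swap x (a b : {ffun 'I_x -> 'I_n}) i j J :
  off a b i -> off a b j -> J i -> ~~ J j ->
  polygen a b J - polygen a b (swap_bits J i j) =
  polygen (extend_tab a j) (extend_tab b i) J.
Proof.
move=> oi oj Ji Jj; apply/ffunP => I; rewrite !ffunE.
have ij : i != j by apply: contraNneq Jj => <-.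
rewrite big_ord_recl !extend_tab0.
under [in RHS]eq_bigr => c _ do rewrite !extend_tabS.
have offE q : off (extend_tab a j) (extend_tab b i) q =
    (off a b q && (q != i)) && (q != j).
  by rewrite /off !codom_extend_tab !inE !negb_or; do !case: (_ == _); rewrite /= ?andbT ?andbF.
rewrite (eq_bigl _ _ offE).
rewrite (bigD1 i) //= [in X in _ - _ * X](bigD1 i) //=.
rewrite (bigD1 j) /=; last by rewrite oj eq_sym.
rewrite [in X in _ - _ * (_ * X)](bigD1 j) /=; last by rewrite oj eq_sym.
have e : \prod_(q < n | (off a b q && (q != i)) && (q != j)) (I q == swap_bits J i j q)%:R =
   \prod_(q < n | (off a b q && (q != i)) && (q != j)) (I q == J q)%:R :> C.
  apply: eq_bigr => q /andP[/andP[_ qi] qj]; rewrite ffunE tpermD //; by rewrite eq_sym.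
rewrite e !ffunE tpermL tpermR Ji (negPf Jj) /singlet.
by case: (I i); case: (I j) => /=; ring.
Qed.

End Polytabloids.

(** * Isotypic decomposition *)

Section Isotypic.
Variables (R : realType) (n : nat).
Local Notation C := (R[i]).
Implicit Types (u v w : qstate R n) (I J : bits n) (f : qstate R n -> qstate R n).

Lemma in_isotypic0 x : in_isotypic x (0 : qstate R n).
Proof. by exists [::]; split=> //; rewrite big_nil. Qed.

Lemma in_isotypicD x u v : in_isotypic x u -> in_isotypic x v -> in_isotypic x (u + v).
Proof.
move=> [s [hs ->]] [t [ht ->]]; exists (s ++ t); split; last by rewrite big_cat.
move=> p; elim: s hs => [|q s IHs] hs /=; first exact: ht.
case=> [<-|]; first by apply: hs; left.
by apply: IHs => r rs; apply: hs; right.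
Qed.

Lemma in_isotypicZ x (z : C) v : in_isotypic x v -> in_isotypic x (cscale z v).
Proof.
move=> [s [hs ->]]; elim: s hs => [|q s IHs] hs.
  by rewrite big_nil cscaler0; apply: in_isotypic0.
rewrite big_cons cscaleDr; apply: in_isotypicD; last first.
  by apply: IHs => r rs; apply: hs; right.
exists [:: ((fun v => cscale z (q.1 v)), q.2)]; rewrite big_seq1; split=> // p [<-|//] /=.
have [e h] := hs q (or_introl erefl); split=> //; exact: equivariant_lin_cscale.
Qed.

Lemma in_isotypicB x u v : in_isotypic x u -> in_isotypic x v -> in_isotypic x (u - v).
Proof.
by move=> hu hv; apply: in_isotypicD => //; rewrite -cscaleN1; apply: in_isotypicZ.
Qed.

Lemma in_isotypic_polytab x (a b : {ffun 'I_x -> 'I_n}) f :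
  tableau_ok a b -> equivariant_lin f -> in_isotypic x (f (polytab R a b)).
Proof.
move=> ok ef; exists [:: (f, polytab R a b)]; rewrite big_seq1; split=> // p [<-|//] /=.
split=> //; exists [ffun t => (t == (a, b))%:R].
rewrite (bigD1 (a, b)) //= ffunE eqxx cscale1 big1 ?addr0 // => t /andP[_ /negPf ne].
by rewrite ffunE ne; apply/ffunP => I; rewrite !ffunE mul0r.
Qed.

Lemma casimirD u w : casimir (u + w) = casimir u + casimir w.
Proof.
apply/ffunP => I; rewrite [RHS]ffunE !casimirE -big_split; apply: eq_bigr => i _.
by rewrite -big_split; apply: eq_bigr => j _; rewrite !ffunE opprD addrACA.
Qed.

Lemma casimir0 : casimir 0 = 0 :> qstate R n.
Proof.
apply/ffunP => I; rewrite casimirE [RHS]ffunE big1 // => i _.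
by rewrite big1 // => j _; rewrite !ffunE subrr.
Qed.

Lemma casimirZ (z : C) u : casimir (cscale z u) = cscale z (casimir u).
Proof.
by rewrite (casimir_equivariant _ (equivariant_lin_cscale z (@equivariant_lin_id R n))).
Qed.

Lemma casimir_sum (T : Type) (r : seq T) (P : pred T) (F : T -> qstate R n) :
  casimir (\sum_(i <- r | P i) F i) = \sum_(i <- r | P i) casimir (F i).
Proof. exact: (big_morph _ casimirD casimir0). Qed.

(** Equivariant maps commute with the Casimir element, so the eigenvalue on polytabloids passes to
    their images. *)
Lemma casimir_isotypic x v :
  in_isotypic x v -> casimir v = cscale (x%:R * (n%:R + 1 - x%:R)) v.
Proof.
move=> [s [hs ->]]; elim: s hs => [|q s IHs] hs.
  by rewrite big_nil casimir0 cscaler0.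
rewrite big_cons casimirD cscaleDr; congr (_ + _); last first.
  by apply: IHs => r rs; apply: hs; right.
have [e [coef ->]] := hs q (or_introl erefl).
rewrite -casimir_equivariant // -equivariant_linZ //; congr q.1.
rewrite cscale_sumr casimir_sum; apply: eq_bigr => t ok.
by rewrite casimirZ casimir_polytab // !cscaleA mulrC.
Qed.

Definition decomposable v : Prop :=
  exists w : 'I_(n./2).+1 -> qstate R n,
    (forall x : 'I_(n./2).+1, in_isotypic x (w x)) /\ v = \sum_x w x.

Lemma decomposable_isotypic x v : (x <= n./2)%N -> in_isotypic x v -> decomposable v.
Proof.
rewrite -ltnS => lx hv.
exists (fun y => if y == Ordinal lx then v else 0); split.
  by move=> y; case: eqP => [->|] //; move=> _; apply: in_isotypic0.
by rewrite -big_mkcond big_pred1_eq.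
Qed.

Lemma decomposableD u v : decomposable u -> decomposable v -> decomposable (u + v).
Proof.
move=> [s [hs ->]] [t [ht ->]]; exists (fun x => s x + t x); split.
  by move=> x; apply: in_isotypicD.
by rewrite big_split.
Qed.

Lemma decomposableZ (z : C) v : decomposable v -> decomposable (cscale z v).
Proof.
move=> [s [hs ->]]; exists (fun x => cscale z (s x)); split.
  by move=> x; apply: in_isotypicZ.
by rewrite cscale_sumr.
Qed.

Lemma decomposable_sum (T : Type) (r : seq T) (P : pred T) (F : T -> qstate R n) :
  (forall i, P i -> decomposable (F i)) -> decomposable (\sum_(i <- r | P i) F i).
Proof.
move=> h; elim/big_ind: _ => //; last exact: decomposableD.
by apply: (@decomposable_isotypic 0) => //; apply: in_isotypic0.
Qed.

(* Two basis vectors of equal weight outside the tableau are linked by a chain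
   of swaps. *)
Lemma polygen_sub_decomposable x (a b : {ffun 'I_x -> 'I_n}) J J' :
  (forall i j J, off a b i -> off a b j -> J i -> ~~ J j ->
     decomposable (polygen R a b J - polygen R a b (swap_bits J i j))) ->
  (\sum_(i < n | off a b i) J i = \sum_(i < n | off a b i) J' i)%N ->
  decomposable (polygen R a b J - polygen R a b J').
Proof.
move=> sw; pose dist J := #|[set i | off a b i && (J i != J' i)]|.
move: {2}(dist J).+1 (ltnSn (dist J)) => d; elim: d J => [//|d IHd] J.
rewrite ltnS => le eq.
have [/exists_inP[i oi /andP[Ji nJi]]|/exists_inPn none] :=
    boolP [exists (i | off a b i), J i && ~~ J' i]; last first.
  (* Without such a site [J <= J'] outside the tableau, and equal sums make this an equality. *)
  have le1 i : off a b i -> (J i <= J' i)%N.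
    by move=> /none; rewrite negb_and negbK; case: (J i); case: (J' i).
  have := leqif_sum (fun i oi => leqif_eq (le1 i oi)); case=> _.
  rewrite eq eqxx => /esym/forall_inP h.
  suff -> : polygen R a b J = polygen R a b J'.
    by rewrite subrr; apply: (@decomposable_isotypic 0) => //; apply: in_isotypic0.
  apply/ffunP => I; rewrite !ffunE; congr (_ * _); apply: eq_bigr => i oi.
  by congr ((_ == _)%:R); have := h i oi; case: (J i); case: (J' i).
have [/exists_inP[j oj /andP[Jj nJj]]|/exists_inPn none] :=
    boolP [exists (j | off a b j), ~~ J j && J' j]; last first.
  have le1 i' : off a b i' -> (J' i' <= J i')%N.
    by move=> /none; rewrite negb_and negbK; case: (J i'); case: (J' i').
  have := leqif_sum (fun i oi => leqif_eq (le1 i oi)); case=> _.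
  rewrite eq eqxx => /esym/forall_inP/(_ i oi).
  by rewrite Ji (negPf nJi).
have ij : i != j by apply: contraNneq Jj => <-.
have sE : (\sum_(q < n | off a b q) swap_bits J i j q = \sum_(q < n | off a b q) J q)%N.
  rewrite [LHS](reindex_inj (@perm_inj _ (tperm i j))) /=; apply: eq_big => q.
    by case: tpermP => // ->; rewrite ?oi ?oj.
  by rewrite ffunE tpermK.
rewrite -(subrK (polygen R a b (swap_bits J i j)) (polygen R a b J)) -addrA.
apply: decomposableD; first exact: sw.
apply: IHd; last by rewrite sE.
apply: leq_trans le; apply: proper_card; apply/properP; split.
  apply/subsetP => q; rewrite !inE => /andP[-> ] /=; rewrite ffunE.
  by case: tpermP => [->|->|//] _; rewrite ?Ji ?nJj ?(negPf nJi) ?(negPf Jj).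
by exists i; rewrite !inE oi ?Ji ?(negPf nJi) // ffunE tpermL (negPf Jj).
Qed.

(* Descending induction on the number [x] of singlets: modulo vectors with one
   more singlet, every [polygen a b J] equals the average over [J], which is the
   image of a polytabloid under [raise_to]. *)
Lemma polygen_decomposable x (a b : {ffun 'I_x -> 'I_n}) J :
  tableau_ok a b -> decomposable (polygen R a b J).
Proof.
(* [d] is the fuel of the induction: at [d = 0] the tableau would need more than [n] sites. *)
have [d le] : exists d, (n < x.*2 + d)%N by exists n.+1; rewrite addnS ltnS leq_addl.
elim: d x a b J le => [|d IHd] x a b J le ok.
  by move: le; rewrite addn0 ltnNge (tableau_size ok).
set wt := (\sum_(i < n | off a b i) J i)%N.
pose Q (K : bits n) := [forall i, K i ==> off a b i] && (\sum_(i < n | off a b i) K i == wt)%N.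
pose N := (\sum_(K : bits n | Q K) 1)%N.
(* The pattern of [J] outside the tableau is among those counted, so averaging over them makes
   sense. *)
have N0 : (N%:R : C) != 0.
  pose J0 : bits n := [ffun i => J i && off a b i].
  rewrite pnatr_eq0 /N (bigD1 J0) //; apply/andP; split.
    by apply/forallP => i; rewrite ffunE; apply/implyP => /andP[].
  by apply/eqP; apply: eq_bigr => i oi; rewrite ffunE oi andbT.
suff h : decomposable (cscale N%:R (polygen R a b J)).
  by have := decomposableZ N%:R^-1 h; rewrite cscaleA mulVf // cscale1.
have -> : cscale N%:R (polygen R a b J) =
    \sum_(K | Q K) (polygen R a b J - polygen R a b K) + \sum_(K | Q K) polygen R a b K.
  rewrite -big_split /= (eq_bigr (fun=> polygen R a b J)); last by move=> K _; rewrite subrK.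
  apply/ffunP => I; rewrite cscaleE sum_ffunE /N natr_sum mulr_suml.
  by apply: eq_bigr => K _; rewrite mul1r.
apply: decomposableD.
  apply: decomposable_sum => K /andP[_ /eqP eK].
  apply: polygen_sub_decomposable => [i j J' oi oj Ji Jj|]; last by rewrite eK.
  rewrite polygen_swap //; apply: IHd.
    by move: le; rewrite doubleS !addSn !addnS => /ltnW.
  by apply: extend_tab_ok => //; apply: contraNneq Jj => <-.
rewrite sum_polygen //; apply: (@decomposable_isotypic x).
  by rewrite geq_half_double (tableau_size ok).
exact: (in_isotypic_polytab ok (@raise_to_equivariant R n _)).
Qed.

(** Over the empty tableau [polygen] is the basis vector [|J>]. *)
Lemma all_decomposable v : decomposable v.
Proof.
pose a : {ffun 'I_0 -> 'I_n} := [ffun c : 'I_0 => False_rect _ (notF (ltn_ord c))].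
have eo : codom a = [::] by apply/size0nil; rewrite size_codom card_ord.
have ok : tableau_ok a a by rewrite /tableau_ok eo.
have -> : v = \sum_J cscale (v J) (polygen R a a J).
  apply/ffunP => I; rewrite sum_ffunE (bigD1 I) //= cscaleE !ffunE big_ord0 mul1r.
  rewrite [X in _ * X]big1 ?mulr1 => [|i _]; last by rewrite eqxx.
  rewrite big1 ?addr0 // => J ne; rewrite cscaleE ffunE big_ord0 mul1r.
  have /existsP[i hi] : [exists i, I i != J i].
    by rewrite -negb_forall; apply: contra ne => /forallP h; apply/eqP/ffunP => i; rewrite (eqP (h i)).
  by rewrite (bigD1 i) /= ?(negPf hi) ?mul0r ?mulr0 // /off eo.
by apply: decomposable_sum => J _; apply/decomposableZ/polygen_decomposable.
Qed.

Definition casimir_value (x : nat) : R := x%:R * (n%:R + 1 - x%:R).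

(** The values differ by [(x - y) (n + 1 - x - y)], and [x + y <= n]. *)
Lemma casimir_value_inj x y : (x <= n./2)%N -> (y <= n./2)%N ->
  casimir_value x = casimir_value y -> x = y.
Proof.
move=> hx hy e; have : (x%:R - y%:R) * (n%:R + 1 - x%:R - y%:R) = 0 :> R.
  by rewrite -[RHS](subrr (casimir_value x)) {2}e /casimir_value; ring.
move/eqP; rewrite mulf_eq0 => /orP[|h]; first by rewrite subr_eq0 eqr_nat => /eqP.
have : (x + y < n.+1)%N by have := odd_double_half n; lia.
rewrite -(ltr_nat R) natrD -natr1; move/eqP: h => h ?; exfalso; lra.
Qed.

Lemma casimir_isotypicE x v :
  in_isotypic x v -> casimir v = cscale ((casimir_value x)%:C)%C v.
Proof.
move=> /casimir_isotypic ->; congr cscale.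
by rewrite -[RHS]/(real_complex R _) rmorphM rmorphB rmorphD !rmorph_nat rmorph1.
Qed.

(** These are eigenvectors of the self-adjoint Casimir element for different eigenvalues. *)
Lemma isotypic_orthogonal x y u v : (x <= n./2)%N -> (y <= n./2)%N -> x != y ->
  in_isotypic x u -> in_isotypic y v -> hdot u v = 0.
Proof.
move=> hx hy ne hu hv; have := hdot_casimir u v.
rewrite (casimir_isotypicE hu) (casimir_isotypicE hv) hdotZl hdotZr => /eqP.
rewrite -subr_eq0 -mulrBl mulf_eq0 => /orP[|/eqP //].
rewrite subr_eq0 => /eqP[] /(casimir_value_inj hy hx) e.
by rewrite e eqxx in ne.
Qed.

(** The specification under [epsilon] has the solution [w x] and no other: the difference of two
    solutions lies in the component and is orthogonal to it, hence to itself. *)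
Lemma orth_proj_isotypic v (w : 'I_(n./2).+1 -> qstate R n) :
  (forall x : 'I_(n./2).+1, in_isotypic x (w x)) -> v = \sum_x w x ->
  forall x : 'I_(n./2).+1, orth_proj (@in_isotypic R n x) v = w x.
Proof.
move=> hw ev x.
have wP u : in_isotypic x u -> hdot u (v - w x) = 0.
  move=> hu; rewrite ev (bigD1 x) //= addrAC subrr add0r hdot_sumr big1 // => y ne.
  by apply: (isotypic_orthogonal (leq_ord x) (leq_ord y)) => //; rewrite eq_sym.
have [oP oO] := epsilon_spec (inhabits 0)
  (fun w => in_isotypic x w /\ forall u, in_isotypic x u -> hdot u (v - w) = 0)
  (ex_intro _ (w x) (conj (hw x) wP)).
rewrite -/(orth_proj (@in_isotypic R n x) v) in oP oO.
set o := orth_proj _ _ in oP oO *.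
apply/eqP; rewrite -subr_eq0; apply/eqP/hdot_eq0.
have hd := in_isotypicB oP (hw x).
have -> : hdot (o - w x) (o - w x) = hdot (o - w x) ((v - w x) - (v - o)).
  by congr hdot; rewrite opprB [RHS]addrC addrA subrK.
by rewrite hdotBr wP // oO // subrr.
Qed.

Lemma Re_scale (a : R) (z : C) : complex.Re ((a%:C)%C * z) = a * complex.Re z.
Proof. by case: z => p q /=; rewrite mul0r subr0. Qed.

Lemma Re_sum (T : Type) (r : seq T) (P : pred T) (F : T -> C) :
  complex.Re (\sum_(i <- r | P i) F i) = \sum_(i <- r | P i) complex.Re (F i).
Proof. by apply: (big_morph _ _ (erefl _)) => -[a b] [c d]. Qed.

Definition casimir_shift (y : R) v : qstate R n := casimir v - cscale (y%:C)%C v.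

(** The shifted operator multiplies the component [w x] by [casimir_value x - y], and the pairing of
    [v] with [w x] is the mass at [x]. *)
Lemma spectral_moments v (y : R) (p : nat) :
  \sum_(x < (n./2).+1) (casimir_value x - y) ^+ p *
     complex.Re (hdot v (orth_proj (@in_isotypic R n x) v)) =
  complex.Re (hdot v (iter p (casimir_shift y) v)).
Proof.
have [w [hw ev]] := all_decomposable v.
have it : iter p (casimir_shift y) v =
    \sum_(x < (n./2).+1) cscale (((casimir_value x - y)%:C)%C ^+ p) (w x).
  elim: p => [|p /= ->].
    by rewrite [LHS]ev; apply: eq_bigr => x _; rewrite expr0 cscale1.
  rewrite /casimir_shift casimir_sum cscale_sumr -sumrB; apply: eq_bigr => x _.
  rewrite casimirZ (casimir_isotypicE (hw x)) !cscaleA exprSr.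
  apply/ffunP => I; rewrite !ffunE (rmorphB (real_complex R)); ring.
rewrite it hdot_sumr Re_sum; apply: eq_bigr => x _.
rewrite (orth_proj_isotypic hw ev) hdotZr -(rmorphXn (real_complex R)).
by rewrite Re_scale.
Qed.

Lemma spectral_ge0 v (x : 'I_(n./2).+1) :
  0 <= complex.Re (hdot v (orth_proj (@in_isotypic R n x) v)).
Proof.
have [w [hw ev]] := all_decomposable v.
rewrite (orth_proj_isotypic hw ev) {1}ev.
have -> : hdot (\sum_x w x) (w x) = hdot (w x) (w x).
  rewrite hdotC hdot_sumr (bigD1 x) //= big1 ?addr0 -?hdotC // => y ne.
  by apply: (isotypic_orthogonal (leq_ord x) (leq_ord y)) => //; rewrite eq_sym.
exact: hdot_ge0.
Qed.

End Isotypic.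

(** * The Casimir element on block-symmetric vectors *)

Section Hopping.
Variables (R : realType) (n l k M N : nat).
Hypotheses (lk : (l <= k)%N) (nE : (k + M + N = n)%N).
Local Notation C := (R[i]).
Implicit Types (I J : bits n) (i j : 'I_n) (p q : 'I_3) (F : nat -> nat -> R).

Definition block i : 'I_3 := if (i < l)%N then 0 else if (i < k)%N then 1 else 2%:R.

Definition ones p I : nat := \sum_(i < n | block i == p) I i.
Definition zeros p I : nat := \sum_(i < n | block i == p) ~~ I i.

Lemma ones_swap p I i j : I i -> ~~ I j ->
  (ones p (swap_bits I i j) + (block i == p) = ones p I + (block j == p))%N.
Proof.
move=> Ii Ij; have ij : j != i by apply: contraNneq Ij => ->.
rewrite /ones big_mkcond [in RHS]big_mkcond /= !(bigD1 (P := xpredT) i) //= !(bigD1 (P := predC1 i) j) //=.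
rewrite !ffunE tpermL tpermR Ii (negPf Ij) [in RHS](eq_bigr (fun s : 'I_n => if block s == p then swap_bits I i j s : nat else 0%N)).
  by case: (_ == _); case: (_ == _); lia.
by move=> s /andP[si sj]; rewrite ffunE tpermD // eq_sym.
Qed.

Lemma ones_zeros p I : (ones p I + zeros p I = \sum_(i < n | block i == p) 1)%N.
Proof. by rewrite -big_split; apply: eq_bigr => i _; case: (I i). Qed.

Lemma zeros_swap p I i j : I i -> ~~ I j ->
  (zeros p (swap_bits I i j) + (block j == p) = zeros p I + (block i == p))%N.
Proof.
move=> Ii Ij; have := ones_swap p Ii Ij.
by have := ones_zeros p I; have := ones_zeros p (swap_bits I i j); lia.
Qed.

Lemma sum_block (V : nmodType) (g : 'I_n -> V) (P : pred 'I_n) :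
  \sum_(i | P i) g i = \sum_(i | P i && (block i == 0)) g i +
    \sum_(i | P i && (block i == 1)) g i + \sum_(i | P i && (block i == 2%:R)) g i.
Proof.
by rewrite (partition_big block predT) //= !big_ord_recl big_ord0 addr0 addrA.
Qed.

Lemma card_below c : (c <= n)%N -> (\sum_(i < n | i < c) 1 = c)%N.
Proof. by move=> cn; rewrite -(big_ord_widen n (fun=> 1%N) cn) sum1_card card_ord. Qed.

Lemma block0 : (\sum_(i < n | block i == 0%R) 1 = l)%N.
Proof.
rewrite -[RHS]card_below; last by lia.
by apply: eq_bigl => i; rewrite /block; case: ltnP => //; case: ltnP.
Qed.

Lemma block1 : (\sum_(i < n | block i == 1%R) 1 = k - l)%N.
Proof.
apply/eqP; rewrite -(eqn_add2l l) subnKC // -{1}block0; apply/eqP.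
rewrite -[RHS]card_below; last by lia.
rewrite [RHS](bigID (fun i : 'I_n => (i < l)%N)) /=; congr addn; apply: eq_bigl => i.
  by rewrite /block; case: ltnP => // h; [rewrite (leq_trans h)|case: ltnP; rewrite andbF].
by rewrite /block; case: ltnP => // h; case: ltnP.
Qed.

Lemma block2 : (\sum_(i < n | block i == 2%:R%R) 1 = M + N)%N.
Proof.
have e : (\sum_(i < n) 1 = l + (k - l) + \sum_(i < n | block i == 2%:R%R) 1)%N.
  by rewrite -{1}block0 -block1; apply: (sum_block (fun=> 1%N) predT).
rewrite sum1_card card_ord (subnKC lk) in e.
by apply/eqP; rewrite -(eqn_add2l k) addnA nE -e.
Qed.

Lemma ones_weight I : (weight I = ones 0%R I + ones 1%R I + ones 2%:R%R I)%N.
Proof. exact: (sum_block (fun i => I i : nat)). Qed.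

(* The Casimir operator minus [y] on vectors whose entry at [I] depends only on the number
   [d] of zeros in the first block and the number [e] of ones in the second one. *)
Definition hop (y : R) F (d e : nat) : R :=
  (l%:R - d%:R) * ((k - l)%:R - e%:R) * (F d e - F d.+1 e.+1)
  + (l%:R - d%:R) * (N%:R - d%:R + e%:R) * (F d e - F d.+1 e)
  + e%:R * d%:R * (F d e - F d.-1 e.-1)
  + e%:R * (N%:R - d%:R + e%:R) * (F d e - F d e.-1)
  + (M%:R + d%:R - e%:R) * d%:R * (F d e - F d.-1 e)
  + (M%:R + d%:R - e%:R) * ((k - l)%:R - e%:R) * (F d e - F d e.+1)
  - y * F d e.

(** Restricted to the weight of [Xi]: for fixed weight [d] and [e] determine the counts in the third
    block. *)
Definition lifts F (v : qstate R n) : Prop :=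
  forall I, weight I = (l + M)%N ->
    v I = ((F (zeros 0 I) (ones 1 I))%:C)%C.

Lemma sum_const_block (b : bool) p I (c : R) :
  \sum_(i < n | (I i == b) && (block i == p)) c = (if b then ones p I else zeros p I)%:R * c.
Proof.
rewrite big_mkcond [LHS](eq_bigr (fun i => (if block i == p then (I i == b : nat) else 0%N)%:R * c)).
  rewrite -mulr_suml -natr_sum -big_mkcond /ones /zeros; congr (_%:R * _).
  by case: b; apply: eq_bigr => i _; case: (I i).
by move=> i _; case: (I i == b); case: (block i == p); rewrite ?mul1r ?mul0r.
Qed.

(** A swap moves a one from a block [p] to a block [q], and the ones of [p] times the zeros of [q]
    count such swaps. Moves inside a block cancel; the six ordered pairs of distinct blocks give the
    six rates of [hop]. *)
Lemma lifts_hop y F v : lifts F v -> lifts (hop y F) (casimir_shift y v).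
Proof.
move=> hv I wI; rewrite /casimir_shift [LHS]ffunE casimirE.
set d := zeros 0 I; set e := ones 1 I.
(* The change of [F] when a one goes from block [p] to block [q]; adding before the truncated
   subtraction makes it 0 for [p = q]. *)
pose T p q : R := F d e - F (d + (p == 0%R) - (q == 0%R))%N (e + (q == 1%R) - (p == 1%R))%N.
have -> : \sum_(i < n | I i) \sum_(j < n | ~~ I j) (v I - v (swap_bits I i j)) =
    ((\sum_(i < n | I i == true) \sum_(j < n | I j == false) T (block i) (block j))%:C)%C.
  rewrite -[RHS]/(real_complex R _) rmorph_sum; apply: eq_big => [i|i Ii].
    by case: (I i).
  rewrite rmorph_sum; apply: eq_big => [j|j Ij]; first by case: (I j).
  rewrite rmorphB !hv //; last first.
    rewrite -wI /weight [RHS](reindex_inj (@perm_inj _ (tperm i j))) /=.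
    by apply: eq_bigr => q _; rewrite ffunE.
  congr (_ - ((F _ _)%:C)%C).
    by have := zeros_swap 0 Ii Ij; rewrite -/d => <-; rewrite addnK.
  by have := ones_swap 1 Ii Ij; rewrite -/e => <-; rewrite addnK.
rewrite !ffunE (hv I wI) -/d -/e.
have rows p : \sum_(j < n | I j == false) T p (block j) =
   (zeros 0 I)%:R * T p 0 + (zeros 1 I)%:R * T p 1 + (zeros 2%:R I)%:R * T p 2%:R.
  rewrite sum_block -!(sum_const_block false).
  by congr (_ + _ + _); apply: eq_bigr => j /andP[_ /eqP ->].
under eq_bigr => i _ do rewrite rows.
rewrite sum_block.
have cols p : \sum_(i < n | (I i == true) && (block i == p))
   ((zeros 0 I)%:R * T (block i) 0 + (zeros 1 I)%:R * T (block i) 1 + (zeros 2%:R I)%:R * T (block i) 2%:R)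
   = (ones p I)%:R * ((zeros 0 I)%:R * T p 0 + (zeros 1 I)%:R * T p 1 + (zeros 2%:R I)%:R * T p 2%:R).
  by rewrite -(sum_const_block true); apply: eq_bigr => i /andP[_ /eqP ->].
rewrite !cols.
have z0 : (ones 0 I)%:R = l%:R - d%:R :> R.
  by rewrite -block0 -(ones_zeros 0 I) natrD addrK.
have z1 : (zeros 1 I)%:R = (k - l)%:R - e%:R :> R.
  by rewrite -block1 -(ones_zeros 1 I) natrD addrC addKr.
have o2 : (ones 2%:R I)%:R = M%:R + d%:R - e%:R :> R.
  have := congr1 (fun x => x%:R : R) (ones_weight I); rewrite wI !natrD z0 -/e; lra.
have z2 : (zeros 2%:R I)%:R = N%:R - d%:R + e%:R :> R.
  have := congr1 (fun x => x%:R : R) (ones_zeros 2%:R I).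
  by rewrite block2 !natrD o2; lra.
rewrite z0 z1 o2 z2 -/d -/e -(rmorphM (real_complex R)) -(rmorphB (real_complex R)).
congr ((_)%:C)%C.
rewrite /T /hop /= ?addn0 ?subn0 ?addn1 ?subn1 /= ?subrr.
ring.
Qed.

End Hopping.

(** * Moments of the Casimir value in the state [Xi] *)

Section XiMoments.
Variables (R : realType) (n l k M N : nat).
Hypotheses (lk : (l <= k)%N) (nE : (k + M + N = n)%N).
Local Notation C := (R[i]).
Implicit Types (I J : bits n) (F : nat -> nat -> R).
Local Notation zeros := (@zeros n l k).
Local Notation ones := (@ones n l k).
Local Notation block := (@block n l k).

Definition xi_support I : bool :=
  [&& zeros 0 I == 0%N, ones 1 I == 0%N & ones 2%:R I == M].

Lemma xi_supportE I :
  [forall i : 'I_n, (i < l)%N ==> I i]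
    && [forall i : 'I_n, ((l <= i) && (i < k))%N ==> ~~ I i]
    && (#|[set i : 'I_n | (k <= i)%N && I i]| == M) = xi_support I.
Proof.
have b0 i : (block i == 0) = (i < l)%N by rewrite /block; case: ltnP => //; case: ltnP.
have b1 i : (block i == 1) = ((l <= i) && (i < k))%N.
  by rewrite /block ltnNge; case: leqP => //= _; case: ltnP.
have b2 i : (block i == 2%:R) = (k <= i)%N.
  rewrite /block; case: (ltnP i l) => h; last by case: ltnP.
  by apply/esym/negbTE; rewrite -ltnNge (leq_trans h).
rewrite /xi_support -andbA; congr [&& _, _ & _].
- rewrite sum_nat_eq0; apply: eq_forallb => i; by rewrite b0 eqb0 negbK.
- rewrite sum_nat_eq0; apply: eq_forallb => i; by rewrite b1 eqb0.
- rewrite cardsE -sum1_card; congr (_ == _); rewrite [LHS]big_mkcond [RHS]big_mkcond /=.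
  by apply: eq_bigr => i _; rewrite b2 unfold_in; case: (k <= i)%N; case: (I i).
Qed.

Lemma xi_support_weight I : weight I = (l + M)%N ->
  xi_support I = (zeros 0 I == 0%N) && (ones 1 I == 0%N).
Proof.
move=> w; rewrite /xi_support; case: eqP => //= z0; case: eqP => //= o1.
have := ones_zeros l k 0 I; rewrite z0 (block0 lk nE) addn0 => o0.
by apply/eqP; move: w; rewrite (ones_weight l k I) o1 o0 addn0 => /addnI.
Qed.

Lemma weight_xi_support I : xi_support I -> weight I = (l + M)%N.
Proof.
move=> /and3P[/eqP z0 /eqP o1 /eqP o2]; rewrite (ones_weight l k) o1 o2 addn0.
by have := ones_zeros l k 0 I; rewrite z0 (block0 lk nE) addn0 => ->.
Qed.

Lemma card_xi_support : #|[set I : bits n | xi_support I]| = 'C(M + N, M).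
Proof.
pose B := [set i : 'I_n | (k <= i)%N].
have cB : #|B| = (M + N)%N.
  have := cardsC B; rewrite card_ord; suff -> : #|~: B| = k by lia.
  have kn : (k <= n)%N by rewrite -nE -addnA leq_addr.
  rewrite -[RHS](card_below kn) sum1dep_card; apply: eq_card => i.
  by rewrite !inE ltnNge.
rewrite -cB -cards_draws.
pose ind (A : {set 'I_n}) : bits n := [ffun i : 'I_n => (i < l)%N || (i \in A)].
have inj : {in [set A : {set 'I_n} | A \subset B & #|A| == M] &, injective ind}.
  move=> A A'; rewrite !inE => /andP[/subsetP sA _] /andP[/subsetP sA' _] e.
  apply/setP => i; have := congr1 (fun f : bits n => f i) e; rewrite !ffunE.
  case: (ltnP i l) => //= il _; apply/idP/idP => [/sA|/sA']; rewrite inE;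
  by move=> h; have := leq_trans il (leq_trans lk h); rewrite ltnn.
rewrite -(card_in_imset inj); apply: eq_card => I; rewrite !inE -xi_supportE.
apply/idP/imsetP => [/andP[/andP[/forallP h0 /forallP h1] h2]|[A]].
  exists [set i : 'I_n | (k <= i)%N && I i].
    by rewrite !inE h2 andbT; apply/subsetP => i; rewrite !inE => /andP[].
  apply/ffunP => i; rewrite ffunE inE; have := h0 i; have := h1 i.
  by case: ltnP => //= il; case: ltnP => //= ik /negPf.
rewrite inE => /andP[/subsetP sA cA] ->.
have inA i : i \in A -> (k <= i)%N by move=> /sA; rewrite inE.
apply/andP; split; [apply/andP; split|].
- by apply/forallP => i; rewrite ffunE; case: (i < l)%N.
- apply/forallP => i; rewrite ffunE; apply/implyP => /andP[li ik].
  by rewrite ltnNge li /=; apply/negP => /inA; rewrite leqNgt ik.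
- rewrite -(eqP cA); apply/eqP/eq_card => i; rewrite inE ffunE.
  apply/idP/idP => [/andP[ki /orP[il|//]]|iA]; last by rewrite iA orbT andbT inA.
  by have := leq_trans il (leq_trans lk ki); rewrite ltnn.
Qed.

(** The profile of [Xi] up to its normalisation. *)
Definition origin (d e : nat) : R := ((d == 0%N) && (e == 0%N))%:R.

Lemma hopZ (c y : R) F d e :
  hop l k M N y (fun d e => c * F d e) d e = c * hop l k M N y F d e.
Proof. by rewrite /hop; ring. Qed.

Lemma hop_ext (y : R) F G : F =2 G -> hop l k M N y F =2 hop l k M N y G.
Proof. by move=> e d f; rewrite /hop !e. Qed.

Lemma iter_hopZ (c y : R) F p d e :
  iter p (hop l k M N y) (fun d e => c * F d e) d e = c * iter p (hop l k M N y) F d e.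
Proof.
by elim: p d e => [//|p IHp] d e /=; rewrite (hop_ext y IHp) hopZ.
Qed.

(** [Xi] lifts a multiple of [origin], and pairing with it sees only the value at [(0, 0)]; the
    squared normalisation cancels the size of the support. For [p = 0] this says that the masses add
    up to 1. *)
Lemma xi_moments (y : R) (p : nat) :
  \sum_(x < (n./2).+1) (casimir_value R n x - y) ^+ p * pmf R n (l + M) k l x =
  iter p (hop l k M N y) origin 0 0.
Proof.
rewrite spectral_moments.
have Xm : ((l + M) - l)%N = M by rewrite addKn.
have Xn : (n + l - (l + M) - k)%N = N by lia.
pose c : R := (Num.sqrt 'C(M + N, M)%:R)^-1.
pose X := Xi R n (l + M) k l.
have XE I : X I = if xi_support I then (c%:C)%C else 0.
  by rewrite ffunE Xm Xn xi_supportE.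
have lX : lifts l k M (fun d e => c * origin d e) X.
  move=> I wI; rewrite XE xi_support_weight // /origin.
  by case: (_ && _); rewrite ?mulr1 ?mulr0.
have lp : lifts l k M (iter p (hop l k M N y) (fun d e => c * origin d e))
    (iter p (casimir_shift y) X).
  by elim: p => [//|p IHp] /=; apply: lifts_hop.
set m := iter p _ origin 0 0.
have -> : hdot X (iter p (casimir_shift y) X) = ((c ^+ 2 * m *+ 'C(M + N, M))%:C)%C.
  rewrite /hdot (bigID (fun I => xi_support I)) /= [X in _ + X]big1 ?addr0.
    rewrite -card_xi_support -sumr_const (rmorph_sum (real_complex R)).
    rewrite [RHS](eq_bigl (fun I => xi_support I)); last by move=> I; rewrite inE.
    apply: eq_bigr => I sI; rewrite XE sI lp ?weight_xi_support // iter_hopZ.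
    move: (sI) => /and3P[/eqP -> /eqP -> _]; rewrite -/m conjc_real.
    by rewrite -(rmorphM (real_complex R)) mulrA expr2.
  by move=> I /negPf sI; rewrite XE sI conjc0 mul0r.
rewrite /= -mulr_natr mulrAC.
have c0 : (0 : R) < 'C(M + N, M)%:R by rewrite ltr0n bin_gt0 leq_addr.
by rewrite /c exprVn sqr_sqrtr ?ltW // mulVf ?mul1r ?gt_eqF.
Qed.

Lemma pmf_ge0 m (x : 'I_(n./2).+1) : 0 <= pmf R n m k l x.
Proof. exact: spectral_ge0. Qed.

End XiMoments.

(** * Bounds on the hopping operator *)

Section HopBounds.
Variables (R : realType) (l k M N : nat) (y : R).
Implicit Types (F : nat -> nat -> R).
Local Notation g := (k - l)%N.

(** The total rate of leaving the origin, which is the mean of [Y]. *)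
Let S : R := l%:R * g%:R + l%:R * N%:R + M%:R * g%:R.

Lemma hop_moment1 : hop l k M N y (@origin R) 0 0 = S - y.
Proof. by rewrite /hop /origin /S /=; ring. Qed.

(** Besides the diagonal term squared, the walk leaves and returns in two hops: through [(1, 1)]
    with weight [l g], through [(1, 0)] with [l N (M + 1)], through [(0, 1)] with [M g (N + 1)]. *)
Lemma hop_moment2 : iter 2 (hop l k M N y) (@origin R) 0 0 =
  (S - y) ^+ 2 + S + l%:R * N%:R * M%:R + M%:R * g%:R * N%:R.
Proof. by rewrite /= /hop /origin /S /=; ring. Qed.

Variables (nu r : R).
Hypotheses (r1 : 1 <= r) (nuE : nu = r ^+ 2).
Hypotheses (l_le : l%:R <= nu) (g_le : g%:R <= nu) (M_le : M%:R <= nu) (N_le : N%:R <= nu).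
Hypothesis y_near : `|S - y| <= nu.

Let r0 : 0 <= r. Proof. exact: le_trans ler01 r1. Qed.

(** [f] is a value [t] levels farther from the origin, where its weighted bound is better by
    [r ^ t]; the rate [c] may be larger by the same factor. In [down_bound] the roles are
    reversed. *)
Lemma up_bound (K A c f : R) (w t : nat) : 0 <= K ->
  `|c| <= K * r ^+ (3 + t) -> `|f| * r ^+ (w + t) <= A ->
  `|c * f| * r ^+ w <= K * r ^+ 3 * A.
Proof.
move=> K0 hc hf; rewrite normrM.
apply: (le_trans (y := K * r ^+ (3 + t) * (`|f| * r ^+ w))).
  by rewrite -[leLHS]mulrA ler_wpM2r // mulr_ge0 // exprn_ge0.
rewrite exprD (_ : _ * _ = K * r ^+ 3 * (`|f| * r ^+ (w + t))); last by rewrite exprD; ring.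
by rewrite ler_wpM2l // mulr_ge0 // exprn_ge0.
Qed.

Lemma down_bound (K A c f : R) (w t : nat) : (t <= 3)%N ->
  `|c| <= K * r ^+ (3 - t) -> `|f| * r ^+ w <= A -> 0 <= K ->
  `|c * f| * r ^+ (w + t) <= K * r ^+ 3 * A.
Proof.
move=> t3 hc hf K0; rewrite normrM.
apply: (le_trans (y := K * r ^+ (3 - t) * (`|f| * r ^+ (w + t)))).
  by rewrite -[leLHS]mulrA ler_wpM2r // mulr_ge0 // exprn_ge0.
rewrite exprD (_ : _ * _ = K * r ^+ 3 * (`|f| * r ^+ w)).
  by rewrite ler_wpM2l // mulr_ge0 // exprn_ge0.
by rewrite -[in r ^+ 3](subnK t3) exprD; ring.
Qed.

(* In the weight [r ^ (d + e)], with [r = sqrt n], a hop away from the origin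
   (rate of order [n ^ 2]) gains at least a factor [1 / r], and a hop towards it
   costs as much as its smaller rate allows; so [hop] has norm of order [r ^ 3]. *)
Lemma hop_bound (q A : R) F (d e : nat) :
  1 <= q -> d%:R <= q -> e%:R <= q ->
  (forall d' e', (d' + e' <= d + e + 2)%N -> `|F d' e'| * r ^+ (d' + e') <= A) ->
  `|hop l k M N y F d e| * r ^+ (d + e) <= 91 * q ^+ 2 * r ^+ 3 * A.
Proof.
move=> q1 dq eq hF.
move: (r1) (nuE) (l_le) (g_le) (M_le) (N_le) => hr1 hnu hl hg hM hN.
(* 13 counts the products in the diagonal coefficient [c6] with multiplicity, [1 + 3 + 3 + 6]; 91 is
   13 for each of the seven terms of [hopE]. *)
pose K := 13 * q ^+ 2.
have K0 : 0 <= K by rewrite /K; nra.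
have nu1 : 1 <= nu by rewrite nuE; nra.
have q0 : 0 <= q by lra.
have nu0 : 0 <= nu by lra.
have [d0 e0] : 0 <= d%:R :> R /\ 0 <= e%:R :> R by split; rewrite ler0n.
have [l0 g0] : 0 <= l%:R :> R /\ 0 <= g%:R :> R by split; rewrite ler0n.
have [M0 N0] : 0 <= M%:R :> R /\ 0 <= N%:R :> R by split; rewrite ler0n.
have qnu : q <= q * nu by nra.
have nq : nu <= q * nu by nra.
have bl : `|l%:R - d%:R : R| <= q * nu by rewrite ler_norml; apply/andP; split; lra.
have bg : `|g%:R - e%:R : R| <= q * nu by rewrite ler_norml; apply/andP; split; lra.
have bN : `|N%:R - d%:R + e%:R : R| <= 2 * (q * nu) by rewrite ler_norml; apply/andP; split; lra.
have bM : `|M%:R + d%:R - e%:R : R| <= 2 * (q * nu) by rewrite ler_norml; apply/andP; split; lra.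
have bd : `|d%:R : R| <= q by rewrite ger0_norm.
have be : `|e%:R : R| <= q by rewrite ger0_norm.
have prod_le (a b A1 B1 B : R) : `|a| <= A1 -> `|b| <= B1 -> A1 * B1 <= B -> `|- (a * b)| <= B.
  by move=> ha hb h; rewrite normrN normrM; apply: le_trans h; apply: ler_pM.
have hr2 : 1 <= r ^+ 2 by rewrite exprn_ege1.
have r23 : r ^+ 2 <= r ^+ 3 by rewrite (exprSr r 2) ler_peMr // exprn_ge0.
have r45 : r ^+ 4 <= r ^+ 5 by rewrite (exprSr r 4) ler_peMr // exprn_ge0.
have nu2 : nu * nu = r ^+ 4 by rewrite nuE; ring.
pose c0 : R := - ((l%:R - d%:R) * (g%:R - e%:R)).
pose c1 : R := - ((l%:R - d%:R) * (N%:R - d%:R + e%:R)).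
pose c2 : R := - (e%:R * d%:R).
pose c3 : R := - (e%:R * (N%:R - d%:R + e%:R)).
pose c4 : R := - ((M%:R + d%:R - e%:R) * d%:R).
pose c5 : R := - ((M%:R + d%:R - e%:R) * (g%:R - e%:R)).
(* The exit rates add up to order [n ^ 2], too much for a term that does not move; subtracting [y]
   cancels that order. *)
pose c6 : R := S - y + (d%:R * (M%:R - l%:R - N%:R) + e%:R * (N%:R - M%:R - g%:R)
   + 2 * (d%:R ^+ 2 + e%:R ^+ 2 - d%:R * e%:R)).
have hopE : hop l k M N y F d e = c0 * F d.+1 e.+1 + c1 * F d.+1 e + c2 * F d.-1 e.-1
    + c3 * F d e.-1 + c4 * F d.-1 e + c5 * F d e.+1 + c6 * F d e.
  by rewrite /hop /c0 /c1 /c2 /c3 /c4 /c5 /c6 /S; ring.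
have q2 : 0 <= q ^+ 2 by rewrite exprn_ge0.
have up (a b c : R) (ka kb : R) : `|a| <= ka * (q * nu) -> `|b| <= kb * (q * nu) ->
    0 <= ka -> 0 <= kb -> ka * kb <= 13 -> `|- (a * b)| <= K * r ^+ 4.
  move=> ha hb ka0 kb0 kk; apply: (prod_le _ _ _ _ _ ha hb).
  rewrite (_ : _ * _ = ka * kb * (q ^+ 2 * r ^+ 4)); last by rewrite -nu2; ring.
  by rewrite /K -[leRHS]mulrA; apply: ler_wpM2r => //; rewrite mulr_ge0 // exprn_ge0.
have b0 : `|c0 * F d.+1 e.+1| * r ^+ (d + e) <= K * r ^+ 3 * A.
  apply: (@up_bound _ _ _ _ _ 2) => //.
    apply: (le_trans (up _ _ 0 1 1 _ _ _ _ _)); rewrite ?mul1r ?ler01 //; first lra.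
    by rewrite ler_wpM2l.
  by have := hF d.+1 e.+1; rewrite addSn addnS addn2; apply.
have b1 : `|c1 * F d.+1 e| * r ^+ (d + e) <= K * r ^+ 3 * A.
  apply: (@up_bound _ _ _ _ _ 1) => //.
    by apply: (up _ _ 0 1 2); rewrite ?mul1r ?ler01 //; lra.
  by have := hF d.+1 e; rewrite addSn addn1; apply; rewrite addn2 ltnW.
have b5 : `|c5 * F d e.+1| * r ^+ (d + e) <= K * r ^+ 3 * A.
  apply: (@up_bound _ _ _ _ _ 1) => //.
    by apply: (up _ _ 0 2 1); rewrite ?mul1r ?ler01 //; lra.
  by have := hF d e.+1; rewrite addnS addn1; apply; rewrite addn2 ltnW.
have A0 : 0 <= A.
  by apply: le_trans (hF d e _); rewrite ?leq_addr // mulr_ge0 // exprn_ge0.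
have rhs0 : 0 <= K * r ^+ 3 * A by rewrite (mulr_ge0 (mulr_ge0 K0 (exprn_ge0 3 r0)) A0).
have b2 : `|c2 * F d.-1 e.-1| * r ^+ (d + e) <= K * r ^+ 3 * A.
  (* At [d = 0] or [e = 0] the rate vanishes, so the truncated predecessors do no harm. *)
  case: (posnP d) => [dz|dp]; first by rewrite /c2 dz mulr0 oppr0 mul0r normr0 mul0r.
  case: (posnP e) => [ez|ep]; first by rewrite /c2 ez mul0r oppr0 mul0r normr0 mul0r.
  rewrite (_ : (d + e = d.-1 + e.-1 + 2)%N); last by rewrite addn2 -addnS -addSn !prednK.
  apply: down_bound => //; last first.
    by apply: hF; rewrite (leq_trans _ (leq_addr _ _)) // leq_add ?leq_pred.
  apply: (prod_le _ _ _ _ _ be bd); rewrite /K -expr2 /= expr1; nra.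
have b3 : `|c3 * F d e.-1| * r ^+ (d + e) <= K * r ^+ 3 * A.
  case: (posnP e) => [ez|ep]; first by rewrite /c3 ez mul0r oppr0 mul0r normr0 mul0r.
  rewrite (_ : (d + e = d + e.-1 + 1)%N); last by rewrite -addnA addn1 prednK.
  apply: down_bound => //; last first.
    by apply: hF; rewrite (leq_trans _ (leq_addr _ _)) // leq_add ?leq_pred.
  apply: (prod_le _ _ _ _ _ be bN); rewrite /K nuE; nra.
have b4 : `|c4 * F d.-1 e| * r ^+ (d + e) <= K * r ^+ 3 * A.
  case: (posnP d) => [dz|dp]; first by rewrite /c4 dz mulr0 oppr0 mul0r normr0 mul0r.
  rewrite (_ : (d + e = d.-1 + e + 1)%N); last by rewrite addnAC addn1 prednK.
  apply: down_bound => //; last first.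
    by apply: hF; rewrite (leq_trans _ (leq_addr _ _)) // leq_add ?leq_pred.
  apply: (prod_le _ _ _ _ _ bM bd); rewrite /K nuE; nra.
have b6 : `|c6 * F d e| * r ^+ (d + e) <= K * r ^+ 3 * A.
  apply: (@up_bound _ _ _ _ _ 0) => //; last first.
    by rewrite addn0; apply: hF; rewrite leq_addr.
  have pq (a b : R) : 0 <= a -> a <= q -> 0 <= b -> b <= nu -> 0 <= a * b <= q ^+ 2 * nu.
    move=> a0 aq b0' bn; rewrite mulr_ge0 //=; apply: le_trans (ler_pM a0 b0' aq bn) _.
    by rewrite ler_wpM2r // expr2 ler_peMl.
  have pqq (a b : R) : 0 <= a -> a <= q -> 0 <= b -> b <= q -> 0 <= a * b <= q ^+ 2 * nu.
    move=> a0 aq b0' bn; rewrite mulr_ge0 //=; apply: le_trans (ler_pM a0 b0' aq bn) _.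
    by rewrite -expr2 ler_peMr.
  have /andP[? ?] := pq _ _ d0 dq M0 M_le.
  have /andP[? ?] := pq _ _ d0 dq l0 l_le.
  have /andP[? ?] := pq _ _ d0 dq N0 N_le.
  have /andP[? ?] := pq _ _ e0 eq M0 M_le.
  have /andP[? ?] := pq _ _ e0 eq g0 g_le.
  have /andP[? ?] := pq _ _ e0 eq N0 N_le.
  have /andP[? ?] := pqq _ _ d0 dq d0 dq.
  have /andP[? ?] := pqq _ _ e0 eq e0 eq.
  have /andP[? ?] := pqq _ _ d0 dq e0 eq.
  have ? : nu <= q ^+ 2 * nu by rewrite ler_peMl // exprn_ege1.
  apply: (le_trans (y := K * nu)); last by rewrite nuE ler_wpM2l.
  move: y_near; rewrite /c6 /K !ler_norml => /andP[? ?]; apply/andP; split; lra.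
rewrite hopE (_ : 91 * q ^+ 2 * r ^+ 3 * A = K * r ^+ 3 * A *+ 7); last by rewrite /K; ring.
have rw : 0 <= r ^+ (d + e) by rewrite exprn_ge0.
apply: le_trans (ler_wpM2r rw (ler_normD _ _)) _; rewrite mulrDl mulrSr lerD //.
do 4 (apply: le_trans (ler_wpM2r rw (ler_normD _ _)) _; rewrite mulrDl mulrSr lerD //).
by apply: le_trans (ler_wpM2r rw (ler_normD _ _)) _; rewrite mulrDl mulr2n lerD.
Qed.

(** A hop changes [d + e] by at most 2, so four hops from the origin stay in [d + e <= 8], whence
    the 8 in the constant. Four factors [r ^ 3] make [nu ^ 6]. *)
Lemma hop_moment4 :
  `|iter 4 (hop l k M N y) (@origin R) 0 0| <= (91 * 8 ^+ 2) ^+ 4 * nu ^+ 6.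
Proof.
set B : R := 91 * 8 ^+ 2.
have main p (d e : nat) : (p <= 4)%N -> (d + e + p.*2 <= 8)%N ->
    `|iter p (hop l k M N y) (@origin R) d e| * r ^+ (d + e) <= (B * r ^+ 3) ^+ p.
  elim: p d e => [|p IHp] d e p4 de.
    rewrite expr0 /= /origin; case: d e {de} => [|d] [|e] /=;
    by rewrite ?normr1 ?normr0 ?mul0r ?mulr1 ?expr0 ?ler01.
  rewrite exprS; apply: hop_bound.
  - by lra.
  - by rewrite (ler_nat R d 8); lia.
  - by rewrite (ler_nat R e 8); lia.
  - by move=> d' e' h; apply: IHp; lia.
have := main 4 0%N 0%N isT isT; rewrite addn0 expr0 mulr1 => /le_trans; apply.
by rewrite nuE -exprM exprMn -exprM.
Qed.

End HopBounds.

(** * From the moments of the quadratic transform to the mean and variance *)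

Section FiniteExpectation.
Variables (R : realType) (T : finType) (P : T -> R).
Hypothesis P_ge0 : forall i, 0 <= P i.
Implicit Types (f h : T -> R) (c : R).

Definition mean f : R := \sum_i f i * P i.

Lemma meanD f h : mean (fun i => f i + h i) = mean f + mean h.
Proof. by rewrite /mean -big_split; apply: eq_bigr => i _; rewrite mulrDl. Qed.

Lemma meanZ c f : mean (fun i => c * f i) = c * mean f.
Proof. by rewrite /mean mulr_sumr; apply: eq_bigr => i _; rewrite mulrA. Qed.

Lemma eq_mean f h : f =1 h -> mean f = mean h.
Proof. by move=> e; apply: eq_bigr => i _; rewrite e. Qed.

Lemma mean_sub f c : mean (fun=> 1) = 1 -> mean (fun i => f i - c) = mean f - c.
Proof.
move=> P1; rewrite -[in RHS](mulr1 (- c)) -[in RHS]P1 -meanZ -meanD.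
by apply: eq_mean => i; rewrite mulr1.
Qed.

Lemma mean_sqr_sub f c : mean (fun=> 1) = 1 ->
  mean (fun i => (f i - c) ^+ 2) = mean (fun i => f i ^+ 2) - 2 * c * mean f + c ^+ 2.
Proof.
move=> P1; have -> : c ^+ 2 = c ^+ 2 * mean (fun=> 1) by rewrite P1 mulr1.
rewrite -mulNr -!meanZ -!meanD.
by apply: eq_mean => i; ring.
Qed.

Lemma le_mean f h : (forall i, f i <= h i) -> mean f <= mean h.
Proof. by move=> le; apply: ler_sum => i _; rewrite ler_wpM2r. Qed.

Lemma mean_ge0 f : (forall i, 0 <= f i) -> 0 <= mean f.
Proof. by move=> h; apply: sumr_ge0 => i _; rewrite mulr_ge0. Qed.

Lemma ler_norm_mean f h : (forall i, `|f i| <= h i) -> `|mean f| <= mean h.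
Proof.
move=> le; apply: le_trans (ler_norm_sum _ _ _) _; apply: ler_sum => i _.
by rewrite normrM (ger0_norm (P_ge0 i)) ler_wpM2r.
Qed.

(* [Z] is the centred variable and [W = Z (q nu + 1 - Z)] its quadratic
   transform, whose moments are the computable ones. *)
Variables (Z W : T -> R) (nu s q mu sg K : R).
Hypotheses (P1 : mean (fun=> 1) = 1) (s1 : 1 <= s) (nuE : nu = s ^+ 2) (q0 : 0 < q).
Hypotheses (K0 : 0 <= K) (sg0 : 0 <= sg).
Hypothesis WE : forall i, W i = Z i * (q * nu + 1 - Z i).
Hypothesis Z_le : forall i, q * nu / 2 <= q * nu + 1 - Z i.
Hypothesis W1 : mean W = - (nu * mu).
Hypothesis W2 : `|mean (fun i => W i ^+ 2) - nu ^+ 3 * (sg * q ^+ 2)| <= 2 * nu ^+ 2.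
Hypothesis W4 : mean (fun i => W i ^+ 4) <= K * nu ^+ 6.

Definition mom2_const (q sg : R) : R := 4 * (sg + 2 / q ^+ 2).
Definition mom4_const (q K : R) : R := 16 * (K / q ^+ 4).
Definition err2_const (q sg K : R) : R :=
  let C1 := mom2_const q sg in let C2 := mom4_const q K in
  (2 + (2 * q + 1) * C1 + (q + 1) * (C1 + C2) + C2) / q ^+ 2.
Definition err1_const (q sg K : R) : R := (err2_const q sg K + 1 + mom2_const q sg) / q.

Let C1 := mom2_const q sg.
Let C2 := mom4_const q K.

Let nu0 : 0 < nu.
Proof. by rewrite nuE exprn_gt0 // (lt_le_trans ltr01 s1). Qed.

Let nu1 : 1 <= nu.
Proof. by rewrite nuE exprn_ege1. Qed.

Let s0 : 0 < s. Proof. exact: lt_le_trans ltr01 s1. Qed.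

(** The lower bound on the second factor of [W] turns bounds on even moments of [W] into bounds on
    those of [Z]. *)
Lemma Z_le_W i : (q * nu) ^+ 2 / 4 * Z i ^+ 2 <= W i ^+ 2.
Proof.
rewrite WE [leRHS]exprMn [leLHS]mulrC ler_wpM2l ?sqr_ge0 //.
have h0 : 0 <= q * nu / 2 by rewrite divr_ge0 // mulr_ge0 // ltW.
rewrite (_ : _ / 4 = (q * nu / 2) ^+ 2); last by field.
by rewrite ler_sqr ?nnegrE ?Z_le // (le_trans h0 (Z_le i)).
Qed.

Lemma C1_ge0 : 0 <= C1.
Proof. by rewrite /C1 /mom2_const mulr_ge0 // addr_ge0 // divr_ge0 // exprn_ge0 // ltW. Qed.

Lemma C2_ge0 : 0 <= C2.
Proof. by rewrite /C2 /mom4_const mulr_ge0 // divr_ge0 // exprn_ge0 // ltW. Qed.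

Lemma mom2 : mean (fun i => Z i ^+ 2) <= C1 * nu.
Proof.
have h : (q * nu) ^+ 2 / 4 * mean (fun i => Z i ^+ 2) <= nu ^+ 3 * (sg * q ^+ 2) + 2 * nu ^+ 2.
  rewrite -meanZ; apply: le_trans (le_mean Z_le_W) _.
  by move: W2; rewrite ler_norml => /andP[_]; rewrite lerBlDl.
have pos : 0 < (q * nu) ^+ 2 / 4 by rewrite divr_gt0 // exprn_gt0 // mulr_gt0.
rewrite -(ler_pM2l pos); apply: le_trans h _.
have -> : (q * nu) ^+ 2 / 4 * (C1 * nu) = nu ^+ 3 * (sg * q ^+ 2) + 2 * nu ^+ 3.
  by rewrite /C1 /mom2_const; field; rewrite gt_eqF.
by rewrite lerD2l ler_wpM2l // ler_weXn2l.
Qed.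

Lemma mom4 : mean (fun i => Z i ^+ 4) <= C2 * nu ^+ 2.
Proof.
have h : (q * nu) ^+ 4 / 16 * mean (fun i => Z i ^+ 4) <= K * nu ^+ 6.
  apply: le_trans W4; rewrite -meanZ; apply: le_mean => i.
  have := Z_le_W i; rewrite -ler_sqr ?nnegrE ?sqr_ge0 //; last first.
    by rewrite mulr_ge0 ?sqr_ge0 // divr_ge0 ?sqr_ge0.
  rewrite -exprM; apply: le_trans; rewrite le_eqVlt; apply/predU1P; left; by field.
have pos : 0 < (q * nu) ^+ 4 / 16 by rewrite divr_gt0 // exprn_gt0 // mulr_gt0.
rewrite -(ler_pM2l pos); apply: le_trans h _; rewrite le_eqVlt; apply/predU1P; left.
by rewrite /C2 /mom4_const; field; rewrite gt_eqF.
Qed.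

(* AM-GM: [2 |z|^p <= s |z|^(p-1) + |z|^(p+1) / s] *)
Lemma mean_abs1 : `|mean Z| <= (1 + C1) * s.
Proof.
apply: (le_trans (y := mean (fun i => s * 1 + s^-1 * Z i ^+ 2))).
  apply: ler_norm_mean => i; rewrite -(real_normK (num_real (Z i))) mulr1.
  have := normr_ge0 (Z i); move: (`|Z i|) => z z0.
  rewrite -(ler_pM2l s0) mulrDr mulrA mulfV ?gt_eqF // mul1r.
  by have := sqr_ge0 (s - z); have := mulr_ge0 (ltW s0) z0; nra.
rewrite meanD !meanZ P1 mulr1 mulrDl mul1r lerD2l.
rewrite ler_pdivrMl // (_ : s * _ = C1 * nu); last by rewrite nuE; ring.
exact: mom2.
Qed.

Lemma mean_abs3 : `|mean (fun i => Z i ^+ 3)| <= (C1 + C2) / 2 * s ^+ 3.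
Proof.
apply: (le_trans (y := mean (fun i => s / 2 * Z i ^+ 2 + s^-1 / 2 * Z i ^+ 4))).
  apply: ler_norm_mean => i; rewrite normrX.
  rewrite (exprM (Z i) 2 2) -(real_normK (num_real (Z i))).
  have := normr_ge0 (Z i); move: (`|Z i|) => z z0.
  rewrite -subr_ge0 (_ : _ - _ = z ^+ 2 * (s - z) ^+ 2 / (2 * s)); last by field; rewrite gt_eqF.
  apply: divr_ge0; apply: mulr_ge0; rewrite ?sqr_ge0 ?ler0n ?(ltW s0) //; exact: ltW.
rewrite meanD !meanZ.
have e : (C1 + C2) / 2 * s ^+ 3 = s / 2 * (C1 * nu) + s^-1 / 2 * (C2 * nu ^+ 2).
  by rewrite nuE; field; rewrite gt_eqF.
rewrite e; apply: lerD; apply: ler_wpM2l; rewrite ?mom2 ?mom4 // divr_ge0 ?invr_ge0 // ltW //.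
Qed.

(** In the expansion of [W ^ 2] the main term is [q^2 nu^2 Z^2]. The largest of the others is the
    cubic one, of order [nu s^3 = s^5]; division by [nu^2 = s^4] leaves an error of order [s]. *)
Lemma second_moment : `|mean (fun i => Z i ^+ 2) - nu * sg| <= err2_const q sg K * s.
Proof.
have q2 : 0 < q ^+ 2 by rewrite exprn_gt0.
set m2 := mean (fun i => Z i ^+ 2).
pose m3 := mean (fun i => Z i ^+ 3); pose m4 := mean (fun i => Z i ^+ 4).
pose w2 := mean (fun i => W i ^+ 2).
have key : nu ^+ 2 * q ^+ 2 * m2 =
    w2 - 2 * q * nu * m2 + 2 * q * nu * m3 - m2 + 2 * m3 - m4.
  rewrite (_ : w2 = (q * nu + 1) ^+ 2 * m2 + (- 2 * (q * nu + 1)) * m3 + 1 * m4).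
    by ring.
  rewrite -!meanZ -!meanD; apply: eq_mean => i; rewrite WE; ring.
have m20 : 0 <= m2 by apply: mean_ge0 => i; apply: sqr_ge0.
have m40 : 0 <= m4 by apply: mean_ge0 => i; rewrite (exprM _ 2 2) sqr_ge0.
have b2 : m2 <= C1 * s ^+ 2 by rewrite -nuE mom2.
have b4 : m4 <= C2 * s ^+ 4 by rewrite (exprM s 2 2) -nuE mom4.
have b3 := mean_abs3; rewrite -/m3 in b3.
have s45 : s ^+ 4 <= s ^+ 5 by rewrite ler_weXn2l.
have s25 : s ^+ 2 <= s ^+ 5 by rewrite ler_weXn2l.
have s35 : s ^+ 3 <= s ^+ 5 by rewrite ler_weXn2l.
have C10 := C1_ge0; have C20 := C2_ge0.
have e : nu ^+ 2 * q ^+ 2 * (m2 - nu * sg) =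
    (w2 - nu ^+ 3 * (sg * q ^+ 2)) - (2 * q * nu + 1) * m2 + 2 * (q * nu + 1) * m3 - m4.
  by rewrite mulrBr key; ring.
have pos : 0 < nu ^+ 2 * q ^+ 2 by rewrite mulr_gt0 // exprn_gt0.
rewrite -(ler_pM2l pos) -{1}(gtr0_norm pos) -normrM e.
have -> : nu ^+ 2 * q ^+ 2 * (err2_const q sg K * s) =
   2 * s ^+ 5 + (2 * q + 1) * (C1 * s ^+ 5) + 2 * (q + 1) * ((C1 + C2) / 2 * s ^+ 5) + C2 * s ^+ 5.
  by rewrite /err2_const -/C1 -/C2 nuE; field; rewrite gt_eqF.
have t1 : `|w2 - nu ^+ 3 * (sg * q ^+ 2)| <= 2 * s ^+ 5.
  by apply: le_trans W2 _; rewrite ler_wpM2l // nuE -exprM.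
have t2 : `|(2 * q * nu + 1) * m2| <= (2 * q + 1) * (C1 * s ^+ 5).
  have c0 : 0 <= 2 * q * nu + 1 by rewrite addr_ge0 // !mulr_ge0 // ltW.
  rewrite ger0_norm ?mulr_ge0 //.
  apply: (le_trans (y := (2 * q + 1) * nu * (C1 * s ^+ 2))).
    by apply: ler_pM => //; rewrite [leRHS]mulrDl mul1r lerD2l.
  rewrite (_ : _ * _ * _ = (2 * q + 1) * (C1 * s ^+ 4)); last by rewrite nuE; ring.
  apply: ler_wpM2l; first by rewrite addr_ge0 // mulr_ge0 // ltW.
  exact: ler_wpM2l.
have t3 : `|2 * (q * nu + 1) * m3| <= 2 * (q + 1) * ((C1 + C2) / 2 * s ^+ 5).
  have c0 : 0 <= 2 * (q * nu + 1) by rewrite mulr_ge0 // addr_ge0 // mulr_ge0 // ltW.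
  rewrite normrM (ger0_norm c0).
  apply: (le_trans (y := 2 * (q + 1) * nu * ((C1 + C2) / 2 * s ^+ 3))).
    by apply: ler_pM => //; rewrite -[leRHS]mulrA ler_wpM2l // [leRHS]mulrDl mul1r lerD2l.
  by rewrite le_eqVlt; apply/predU1P; left; rewrite nuE; ring.
have t4 : `|m4| <= C2 * s ^+ 5.
  by rewrite ger0_norm //; apply: le_trans b4 _; apply: ler_wpM2l.
do 3 (apply: le_trans (ler_normD _ _) _; rewrite ?normrN; apply: lerD => //).
Qed.

(** Taking means in [W = (q nu + 1) Z - Z^2] gives a linear equation for [mean Z] once [mean W] and
    the second moment are known; its solution is the origin of [phi]. *)
Lemma first_moment : `|mean Z - (sg - mu) / q| <= err1_const q sg K / s.
Proof.
have e : q * nu * (mean Z - (sg - mu) / q) = (mean (fun i => Z i ^+ 2) - nu * sg) - mean Z.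
  have : mean W = (q * nu + 1) * mean Z + (-1) * mean (fun i => Z i ^+ 2).
    by rewrite -!meanZ -meanD; apply: eq_mean => i; rewrite WE; ring.
  rewrite W1 => h; rewrite mulrBr (_ : q * nu * (_ / q) = nu * (sg - mu)); last by field; rewrite gt_eqF.
  by lra.
have pos : 0 < q * nu by rewrite mulr_gt0.
rewrite -(ler_pM2l pos) -{1}(gtr0_norm pos) -normrM e.
have -> : q * nu * (err1_const q sg K / s) = err2_const q sg K * s + (1 + C1) * s.
  by rewrite /err1_const -/C1 nuE; field; rewrite !gt_eqF.
apply: le_trans (ler_normB _ _) _; apply: lerD; [exact: second_moment|exact: mean_abs1].
Qed.

Lemma variance :
  `|(mean (fun i => Z i ^+ 2) - mean Z ^+ 2) / nu - sg| <=
     (err2_const q sg K + (`|(sg - mu) / q| + err1_const q sg K) ^+ 2) / s.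
Proof.
set m2 := mean (fun i => Z i ^+ 2).
have C30 : 0 <= err2_const q sg K.
  by rewrite -(ler_pM2r s0) mul0r; apply: le_trans second_moment.
have C40 : 0 <= err1_const q sg K.
  rewrite /err1_const divr_ge0 ?(ltW q0) //.
  by rewrite addr_ge0 ?C1_ge0 // addr_ge0.
(* As [s >= 1], [mean Z] is bounded, so its square disappears on division by [nu]. *)
have b : `|mean Z| <= `|(sg - mu) / q| + err1_const q sg K.
  rewrite -{1}(subrK ((sg - mu) / q) (mean Z)) addrC.
  apply: le_trans (ler_normD _ _) _; rewrite lerD2l.
  apply: le_trans first_moment _; rewrite ler_pdivrMr //.
  by rewrite ler_peMr.
have e : (m2 - mean Z ^+ 2) / nu - sg = (m2 - nu * sg) / nu - mean Z ^+ 2 / nu.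
  by field; rewrite gt_eqF.
rewrite e; apply: le_trans (ler_normB _ _) _; rewrite [leRHS]mulrDl; apply: lerD.
  rewrite normrM (gtr0_norm (_ : 0 < nu^-1)) ?invr_gt0 // ler_pdivrMr //.
  rewrite (_ : _ * nu = err2_const q sg K * s); first exact: second_moment.
  by rewrite nuE; field; rewrite gt_eqF.
rewrite normrM (gtr0_norm (_ : 0 < nu^-1)) ?invr_gt0 // ler_pM //.
- by rewrite invr_ge0 ltW.
- by rewrite normrX; apply: lerXn2r; rewrite ?nnegrE // addr_ge0.
- by rewrite lef_pV2 ?posrE // nuE expr2 ler_peMr // ltW.
Qed.

Lemma second_moment_scaled :
  `|mean (fun i => Z i ^+ 2) / nu - sg| <= err2_const q sg K / s.
Proof.
have e : mean (fun i => Z i ^+ 2) / nu - sg = (mean (fun i => Z i ^+ 2) - nu * sg) / nu.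
  by field; rewrite gt_eqF.
rewrite e normrM (gtr0_norm (_ : 0 < nu^-1)) ?invr_gt0 // ler_pdivrMr //.
rewrite (_ : _ * nu = err2_const q sg K * s); first exact: second_moment.
by rewrite nuE; field; rewrite gt_eqF.
Qed.

End FiniteExpectation.

(** * The limit theorem *)

Lemma adm_limI (R : realType) (al be ga L C : R) (f : nat -> nat -> nat -> nat -> R) :
  (forall n m k l : nat, (0 < n)%N -> l%:R = al * n%:R -> m%:R = (al + be) * n%:R ->
     k%:R = (al + ga) * n%:R -> `|f n m k l - L| <= C / Num.sqrt n%:R) ->
  adm_lim al be ga f L.
Proof.
move=> h eps e0; pose b := (`|C| / eps) ^+ 2.
exists (Num.bound b).+1 => n m k l le hl hm hk.
have n0 : (0 < n)%N by apply: leq_trans le.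
apply: le_lt_trans (h _ _ _ _ n0 hl hm hk) _.
have s0 : 0 < Num.sqrt (n%:R : R) by rewrite sqrtr_gt0 ltr0n.
rewrite ltr_pdivrMr //; apply: le_lt_trans (ler_norm _) _.
rewrite mulrC -ltr_pdivrMr //.
have h0 : 0 <= `|C| / eps by rewrite divr_ge0 // ltW.
rewrite -(ltr_sqr (x := `|C| / eps)) ?nnegrE ?sqrtr_ge0 //.
rewrite sqr_sqrtr ?ler0n // -/b.
apply: lt_le_trans (archi_boundP (sqr_ge0 _)) _.
by rewrite ler_nat ltnW.
Qed.

(** * The state [Xi] with block sizes proportional to [n] *)

Section ScaledXi.
Variables (R : realType) (al be ga de : R).
Hypotheses (al0 : 0 <= al) (be0 : 0 < be) (ga0 : 0 <= ga) (de0 : 0 < de).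
Hypothesis sum1 : al + be + ga + de = 1.

Let D : R := 1 - 4 * (al * ga + al * de + be * ga).
Let mu : R := (1 - Num.sqrt D) / 2.
Let q : R := Num.sqrt D.
Let sg := (al + ga) * be * de / D.
Let K : R := (91 * 8 ^+ 2) ^+ 4.

(** Positivity of [be] and [de] enters here: it gives [mu < 1/2], hence a nonzero slope [q]. *)
Lemma discr_gt0 : 0 < D.
Proof.
have -> : D = (al + be - ga - de) ^+ 2 + 4 * (be * de).
  rewrite /D -(expr1n _ 2) -{1}sum1; ring.
by rewrite ltr_wpDl ?sqr_ge0 // mulr_gt0 ?mulr_gt0.
Qed.

Variables (n m k l : nat).
Hypotheses (n0 : (0 < n)%N) (lE : l%:R = al * n%:R) (mE : m%:R = (al + be) * n%:R)
  (kE : k%:R = (al + ga) * n%:R).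

Let nu : R := n%:R.
Let s : R := Num.sqrt nu.
Let P (x : 'I_(n./2).+1) : R := pmf R n m k l x.
Let Z (x : 'I_(n./2).+1) : R := x%:R - nu * mu.
(** Centred at the Casimir value of [n mu] rather than at its mean, so that [Z] is a factor of
    [W]. *)
Let W (x : 'I_(n./2).+1) : R :=
  casimir_value R n x - nu * mu * (nu + 1 - nu * mu).

Lemma xi_mean_properties :
  [/\ forall x, 0 <= P x, mean P (fun=> 1) = 1,
      mean P W = - (nu * mu),
      `|mean P (fun x => W x ^+ 2) - nu ^+ 3 * (sg * q ^+ 2)| <= 2 * nu ^+ 2 &
      mean P (fun x => W x ^+ 4) <= K * nu ^+ 6].
Proof.
move: (al0) (be0) (ga0) (de0) (sum1) => ha hb hg hd hs.
have nu0 : 0 < nu by rewrite ltr0n.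
have nu1 : 1 <= nu by rewrite ler1n.
have lk : (l <= k)%N by rewrite -(ler_nat R) lE kE; nra.
have lm : (l <= m)%N by rewrite -(ler_nat R) lE mE; nra.
set M := (m - l)%N; have ME : M%:R = be * nu by rewrite natrB // lE mE; ring.
have gE : (k - l)%:R = ga * nu by rewrite natrB // lE kE; ring.
have kMn : (k + M <= n)%N.
  by rewrite -(ler_nat R) natrD ME kE -/nu -mulrDl ler_piMl ?(ltW nu0) //; lra.
set N := (n - (k + M))%N.
have NE : N%:R = de * nu.
  by rewrite natrB // natrD ME kE -/nu (_ : de = 1 - al - be - ga); [ring|lra].
have nE : (k + M + N = n)%N by rewrite subnKC.
have mlM : m = (l + M)%N by rewrite subnKC.
pose y := nu * mu * (nu + 1 - nu * mu).
have moments p : mean P (fun x => W x ^+ p) = iter p (hop l k M N y) (@origin R) 0 0.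
  by rewrite -(xi_moments lk nE) -mlM.
have q2 : q ^+ 2 = D by rewrite sqr_sqrtr // ltW // discr_gt0.
have q0 : 0 <= q by rewrite sqrtr_ge0.
have D1 : D <= 1.
  rewrite /D gerBl mulr_ge0 // !addr_ge0 ?mulr_ge0 // ltW //.
have q1 : q <= 1 by rewrite -(ler_sqr (x := q)) ?nnegrE // q2 expr1n.
have muE : mu = (1 - q) / 2 by [].
have mu0 : 0 <= mu by lra.
have mu1 : mu <= 2^-1 by lra.
have mumu : mu * (1 - mu) = al * ga + al * de + be * ga.
  have -> : mu * (1 - mu) = (1 - q ^+ 2) / 4 by rewrite muE; field.
  by rewrite q2 /D; field.
pose S : R := l%:R * (k - l)%:R + l%:R * N%:R + M%:R * (k - l)%:R.
have SE : S = nu ^+ 2 * (mu * (1 - mu)).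
  by rewrite /S mumu lE gE NE ME -/nu; ring.
have Sy : S - y = - (nu * mu) by rewrite SE /y; ring.
have w1 : mean P W = - (nu * mu).
  by rewrite -Sy /S -(hop_moment1 l k M N y); apply: (moments 1%N).
have sgD : sg * q ^+ 2 = (al + ga) * be * de.
  by rewrite q2 /sg mulfVK // gt_eqF // discr_gt0.
split=> //.
- by move=> x; apply: pmf_ge0.
- by have := moments 0%N.
- rewrite moments hop_moment2 -/S Sy sgD lE NE ME gE -/nu SE.
  (* The squared mean [(nu mu)^2] and [S = nu^2 mu (1 - mu)] add up to [nu^2 mu]. *)
  rewrite (_ : _ - _ = nu ^+ 2 * mu); last by ring.
  rewrite (ger0_norm (mulr_ge0 (sqr_ge0 nu) mu0)).
  rewrite mulrC; apply: ler_wpM2r; [exact: sqr_ge0|lra].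
- rewrite moments; apply: le_trans (ler_norm _) _.
  have bound (t : R) (j : nat) : t <= 1 -> j%:R = t * nu -> j%:R <= nu.
    by move=> t1 ->; rewrite ler_piMl // ltW.
  apply: (@hop_moment4 _ l k M N y nu s).
  + by rewrite -sqrtr1 ler_wsqrtr.
  + by rewrite sqr_sqrtr // ltW.
  + by apply: bound lE; lra.
  + by apply: bound gE; lra.
  + by apply: bound ME; lra.
  + by apply: bound NE; lra.
  + by rewrite -/S Sy normrN (ger0_norm (mulr_ge0 (ltW nu0) mu0)) ler_piMr ?(ltW nu0) //; lra.
Qed.

Lemma xi_mean_bounds :
  [/\ `|(mean P (fun x => Z x ^+ 2) - mean P Z ^+ 2) / nu - sg| <=
        (err2_const q sg K + (`|(sg - mu) / q| + err1_const q sg K) ^+ 2) / s,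
      `|mean P (fun x => Z x ^+ 2) / nu - sg| <= err2_const q sg K / s,
      `|mean P Z - (sg - mu) / q| <= err1_const q sg K / s &
      mean P (fun=> 1) = 1].
Proof.
have [P0 P1 W1 W2 W4] := xi_mean_properties.
have nu1 : 1 <= nu by rewrite ler1n.
have s1 : 1 <= s by rewrite -sqrtr1 ler_wsqrtr.
have nuE : nu = s ^+ 2 by rewrite sqr_sqrtr // (le_trans ler01).
have q0 : 0 < q by rewrite sqrtr_gt0 discr_gt0.
have K0 : 0 <= K by rewrite exprn_ge0 // mulr_ge0 // exprn_ge0.
have sg0 : 0 <= sg.
  by rewrite /sg divr_ge0 ?(ltW discr_gt0) // !mulr_ge0 ?addr_ge0 // ltW.
have muE : mu = (1 - q) / 2 by [].
have WE x : W x = Z x * (q * nu + 1 - Z x).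
  by rewrite /W /Z /casimir_value muE -/nu; field.
(* The right side decreases in [x] and equals [q nu / 2 + 1] at [x = n/2]. *)
have Zle x : q * nu / 2 <= q * nu + 1 - Z x.
  have : (x.*2 <= n)%N by rewrite -geq_half_double -ltnS.
  rewrite -(ler_nat R) -mul2n natrM -/nu /Z muE => h; nra.
split=> //.
- exact: (variance P0 P1 s1 nuE q0 K0 sg0 WE Zle W1 W2 W4).
- exact: (second_moment_scaled P0 s1 nuE q0 K0 sg0 WE Zle W2 W4).
- exact: (first_moment P0 P1 s1 nuE q0 K0 sg0 WE Zle W1 W2 W4).
Qed.

End ScaledXi.

Theorem theorem5p22 (R : realType) (al be ga de : R) :
  0 <= al -> 0 <= be -> 0 <= ga -> 0 <= de -> al + be + ga + de = 1 ->
  0 < al + ga -> 0 < be -> 0 < de ->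
  let D := 1 - 4 * (al * ga + al * de + be * ga) in
  let mu := (1 - Num.sqrt D) / 2 in
  let sigma2 := (al + ga) * be * de / D in
  let phi := (sigma2 - mu) / (1 - 2 * mu) in
  (* Var[X / sqrt n] -> sigma^2 *)
  adm_lim al be ga
    (fun n m k l =>
       expect n m k l (fun x => (x / Num.sqrt n%:R) ^+ 2)
       - (expect n m k l (fun x => x / Num.sqrt n%:R)) ^+ 2) sigma2 /\
  (* E[((X - n mu) / sqrt n)^2] -> sigma^2 *)
  adm_lim al be ga
    (fun n m k l =>
       expect n m k l (fun x => ((x - n%:R * mu) / Num.sqrt n%:R) ^+ 2)) sigma2 /\
  (* E[X] = n mu + phi + o(1) *)
  adm_lim al be ga
    (fun n m k l => expect n m k l (fun x => x) - n%:R * mu) phi.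
Proof.
move=> al0 _ ga0 _ sum1 _ be0 de0 D mu sigma2 phi.
pose q := Num.sqrt D.
have phiE : phi = (sigma2 - mu) / q by rewrite /phi; congr (_ / _); rewrite /mu -/q; field.
have bounds n m k l n0 lE mE kE :=
  @xi_mean_bounds R al be ga de al0 be0 ga0 de0 sum1 n m k l n0 lE mE kE.
pose K : R := (91 * 8 ^+ 2) ^+ 4.
have sq (n : nat) : (Num.sqrt (n%:R : R)) ^- 2 = n%:R^-1 by rewrite sqr_sqrtr ?ler0n.
split; [|split].
- apply: adm_limI => n m k l n0 lE mE kE.
  have [b _ _ P1] := bounds n m k l n0 lE mE kE; move: b; rewrite -/D -/mu -/q -/sigma2 -/K.
  set P := fun x : 'I_(n./2).+1 => pmf R n m k l x.
  (* The variance is unchanged by the shift [n mu], so the bound for [Z] is one for [X]. *)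
  have E1 : mean P (fun x => x%:R - n%:R * mu) = mean P (fun x => x%:R) - n%:R * mu.
    exact: mean_sub.
  have E2 : mean P (fun x => (x%:R - n%:R * mu) ^+ 2) =
     mean P (fun x => x%:R ^+ 2) - 2 * (n%:R * mu) * mean P (fun x => x%:R) + (n%:R * mu) ^+ 2.
    exact: mean_sqr_sub.
  rewrite E1 E2.
  have -> : expect n m k l (fun x => (x / Num.sqrt n%:R) ^+ 2) = n%:R^-1 * mean P (fun x => x%:R ^+ 2).
    by rewrite -meanZ; apply: eq_mean => x; rewrite expr_div_n sq mulrC.
  have -> : expect n m k l (fun x => x / Num.sqrt n%:R) = (Num.sqrt n%:R)^-1 * mean P (fun x => x%:R).
    by rewrite -meanZ; apply: eq_mean => x; rewrite mulrC.
  rewrite (exprMn _ (Num.sqrt n%:R)^-1) exprVn sq => b; apply: le_trans b; rewrite le_eqVlt; apply/predU1P; left.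
  by congr (`|_ - _|); ring.
- apply: (@adm_limI _ _ _ _ _ (err2_const q sigma2 K)) => n m k l n0 lE mE kE.
  have [_ b _ _] := bounds n m k l n0 lE mE kE; move: b; rewrite -/D -/mu -/q -/sigma2 -/K.
  set P := fun x : 'I_(n./2).+1 => pmf R n m k l x.
  have -> : expect n m k l (fun x => ((x - n%:R * mu) / Num.sqrt n%:R) ^+ 2) =
     mean P (fun x => (x%:R - n%:R * mu) ^+ 2) / n%:R.
  by rewrite [RHS]mulrC -meanZ; apply: eq_mean => x; rewrite expr_div_n sq mulrC.
  exact.
- apply: (@adm_limI _ _ _ _ _ (err1_const q sigma2 K)) => n m k l n0 lE mE kE.
  have [_ _ b P1] := bounds n m k l n0 lE mE kE; move: b; rewrite -/D -/mu -/q -/sigma2 -/K phiE.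
  set P := fun x : 'I_(n./2).+1 => pmf R n m k l x.
  suff -> : mean P (fun x => x%:R - n%:R * mu) = expect n m k l (fun x => x) - n%:R * mu by exact.
  exact: mean_sub.
Qed.
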